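(* The class of sofic groups is closed under the following constructions: (1) direct products, subgroups, inverse limits and direct limits. That is: the direct product $\prod_{i\in I}G_i$ of any family of sofic groups is sofic; every subgroup of a sofic group is sofic; the inverse limit of any inverse system of sofic groups is sofic; the direct limit of any directed system of sofic groups is sofic. (2) free products: the free product of any family of sofic groups is sofic. (3) certain extensions: if $G$ is a group and $N\lhd G$ is a normal subgroup such that $N$ is sofic and $G/N$ is amenable, then $G$ is sofic.
   Context: For a finite set $A$ let $\mathrm{Map}(A)$ denote the monoid of all self-maps of $A$, acting on the right: write $a\cdot f$ for $f(a)$, so $a\cdot fg=(a\cdot f)\cdot g=g(f(a))$. For a real number $\epsilon\in(0,1)$, two elements $e,f\in\mathrm{Map}(A)$ are $\epsilon$-similar if the number of points $a\in A$ with $a\cdot e\neq a\cdot f$ is at most $\epsilon|A|$. They are $(1-\epsilon)$-different if they are not $(1-\epsilon)$-similar. Let $G$ be a group, $\epsilon\in(0,1)$ and $F\subseteq G$ a finite subset. An $(F,\epsilon)$-quasi-action of $G$ on a finite set $A$ is a function $\phi:G\to\mathrm{Map}(A)$ such that: (a) for any two elements $e,f\in F$ the map $\phi(ef)$ is $\epsilon$-similar to $\phi(e)\phi(f)$; (b) $\phi(1)$ is $\epsilon$-similar to the identity map of $A$; (c) for each $e\in F\setminus\{1\}$ the map $\phi(e)$ is $(1-\epsilon)$-different from the identity map of $A$. The group $G$ is sofic if for each $\epsilon\in(0,1)$ and each finite subset $F\subseteq G$ there exists an $(F,\epsilon)$-quasi-action of $G$ on some finite set. Groups are discrete, and amenability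 is that of discrete groups. *)

(* Defs.v *)
From HB Require Import structures.
From mathcomp Require Import all_boot all_order all_algebra.
From mathcomp Require Import finmap boolp classical_sets reals.

Set Implicit Arguments.
Unset Strict Implicit.
Unset Printing Implicit Defensive.

Local Open Scope quotient_scope.
Local Open Scope group_scope.

(* A groupType is an arbitrary, possibly infinite, group; no topology is used. *)

Notation "{ 'ghom' G -> H }" := (UMagmaMorphism.type G H)
  (at level 0, G at level 98, H at level 99,
   format "{ 'ghom'  G  ->  H }") : type_scope.

Section Sofic.
Variable R : realType.

Definition similar (A : finType) (eps : R) (e f : A -> A) : bool :=
  (#|[pred a | e a != f a]|%:R <= eps * #|A|%:R)%R.

Definition different (A : finType) (eps : R) (e f : A -> A) : bool :=
  ~~ similar eps e f.

(* Self-maps act on the right, so the product phi(e)phi(f) sends a to         *)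
(* phi f (phi e a).                                                           *)
Definition quasi_action (G : groupType) (F : {fset G}) (eps : R)
    (A : finType) (phi : G -> A -> A) : Prop :=
  [/\ {in F &, forall e f, similar eps (phi (e * f)) (phi f \o phi e)},
      similar eps (phi 1) id
    & {in F, forall e, e != 1 -> different (1 - eps)%R (phi e) id}].

Definition sofic (G : groupType) : Prop :=
  forall (eps : R) (F : {fset G}), (0 < eps < 1)%R ->
  exists (A : finType) (phi : G -> A -> A), quasi_action F eps phi.

(* Existence of a left-invariant finitely additive probability measure        *)
(* defined on all subsets of the group.                                       *)
Definition amenable (G : groupType) : Prop :=
  exists mu : set G -> R,
    [/\ forall A, (0 <= mu A)%R,
        mu setT = 1%R,
        forall A B, (A `&` B = set0)%classic ->
          mu (A `|` B)%classic = (mu A + mu B)%R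
      & forall (g : G) A, mu ((fun x => g * x) @` A)%classic = mu A].

End Sofic.

Section DirectProduct.
Variables (I : Type) (G : I -> groupType).

Definition dprod : Type := forall i, G i.

HB.instance Definition _ := Choice.on dprod.

Let mul (x y : dprod) : dprod := fun i => x i * y i.
Let one : dprod := fun=> 1.
Let inv (x : dprod) : dprod := fun i => (x i)^-1.

Fact dprod_mulA : associative mul.
Proof. by move=> x y z; apply: functional_extensionality_dep => i; exact: mulgA. Qed.
Fact dprod_mul1g : left_id one mul.
Proof. by move=> x; apply: functional_extensionality_dep => i; exact: mul1g. Qed.
Fact dprod_mulg1 : right_id one mul.
Proof. by move=> x; apply: functional_extensionality_dep => i; exact: mulg1. Qed.
Fact dprod_mulVg : left_inverse one inv mul.
Proof. by move=> x; apply: functional_extensionality_dep => i; exact: mulVg. Qed.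
Fact dprod_mulgV : right_inverse one inv mul.
Proof. by move=> x; apply: functional_extensionality_dep => i; exact: mulgV. Qed.

HB.instance Definition _ := isGroup.Build dprod
  dprod_mulA dprod_mul1g dprod_mulg1 dprod_mulVg dprod_mulgV.

End DirectProduct.

Section Subgroup.
Variables (G : groupType) (S : groupClosed G).

Record subgrp : Type := SubGrp { subgrp_val : G; _ : subgrp_val \in S }.

HB.instance Definition _ := [isSub for subgrp_val].
HB.instance Definition _ := [Choice of subgrp by <:].

Fact subgrp_group_closed : group_closed [pred x | x \in S].
Proof. by split=> [|x y]; rewrite !inE; [exact: gpred1 | exact: gpredF]. Qed.

HB.instance Definition _ := SubChoice_isSubGroup.Build
  G [pred x | x \in S] subgrp subgrp_group_closed.

End Subgroup.

Record inverse_system (d : Order.disp_t) (I : preorderType d) := InverseSystem {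
  inv_obj :> I -> groupType;
  inv_map : forall i j, (i <= j)%O -> {ghom inv_obj j -> inv_obj i};
  inv_map_id : forall i (le_ii : (i <= i)%O) x, inv_map le_ii x = x;
  inv_map_comp : forall i j k (le_ij : (i <= j)%O) (le_jk : (j <= k)%O)
    (le_ik : (i <= k)%O) x, inv_map le_ij (inv_map le_jk x) = inv_map le_ik x
}.

Section InverseLimit.
Variables (d : Order.disp_t) (I : preorderType d) (G : inverse_system I).

Definition thread : pred (dprod G) := fun x =>
  `[< forall i j (le_ij : (i <= j)%O), inv_map G le_ij (x j) = x i >].

Record invlim : Type := InvLim { invlim_val : dprod G; _ : thread invlim_val }.

HB.instance Definition _ := [isSub for invlim_val].
HB.instance Definition _ := [Choice of invlim by <:].

Fact thread_group_closed : group_closed thread.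
Proof.
split=> [|x y /asboolP xP /asboolP yP]; apply/asboolP => i j ij.
  exact: gmulf1.
by rewrite gmulfF xP yP.
Qed.

HB.instance Definition _ :=
  SubChoice_isSubGroup.Build (dprod G) thread invlim thread_group_closed.

End InverseLimit.

Record directed_system (d : Order.disp_t) (I : preorderType d) :=
    DirectedSystem {
  dir_obj :> I -> groupType;
  dir_inhabited : exists i : I, True;
  dir_ub : forall i j : I, exists k, (i <= k)%O && (j <= k)%O;
  dir_map : forall i j, (i <= j)%O -> {ghom dir_obj i -> dir_obj j};
  dir_map_id : forall i (le_ii : (i <= i)%O) x, dir_map le_ii x = x;
  dir_map_comp : forall i j k (le_ij : (i <= j)%O) (le_jk : (j <= k)%O)
    (le_ik : (i <= k)%O) x, dir_map le_jk (dir_map le_ij x) = dir_map le_ik x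
}.


Section DirectLimit.
Variables (d : Order.disp_t) (I : preorderType d) (G : directed_system I).

Definition germ : Type := {i : I & G i}.

HB.instance Definition _ := Choice.on germ.

Let germ_at i (x : G i) : germ := Tagged (fun i => G i) x.

Definition germ_eq : rel germ := fun u v =>
  `[< exists k (le_uk : (tag u <= k)%O) (le_vk : (tag v <= k)%O),
      dir_map G le_uk (tagged u) = dir_map G le_vk (tagged v) >].

Fact germ_eq_refl : reflexive germ_eq.
Proof.
by move=> u; apply/asboolP; exists (tag u), (Order.le_refl _), (Order.le_refl _).
Qed.

Fact germ_eq_sym : symmetric germ_eq.
Proof.
by move=> u v; apply/asboolP/asboolP => -[k [uk [vk e]]]; exists k, vk, uk.
Qed.

Fact germ_eq_trans : transitive germ_eq.
Proof.
move=> v u w /asboolP[k [uk [vk uvk]]] /asboolP[l [vl [wl vwl]]].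
have [m /andP[km lm]] := dir_ub G k l; apply/asboolP.
have um := Order.le_trans uk km; have wm := Order.le_trans wl lm.
have vm := Order.le_trans vk km; exists m, um, wm.
rewrite -(dir_map_comp uk km um) uvk (dir_map_comp vk km vm).
by rewrite -(dir_map_comp vl lm vm) vwl (dir_map_comp wl lm wm).
Qed.

Canonical germ_equiv :=
  EquivRel germ_eq germ_eq_refl germ_eq_sym germ_eq_trans.

Definition dirlim : Type := {eq_quot germ_eq}.

HB.instance Definition _ := Choice.on dirlim.
HB.instance Definition _ := Quotient.on dirlim.

Definition dirlim_in i (x : G i) : dirlim := \pi_dirlim (germ_at x).

Fact dirlim_in_map i j (le_ij : (i <= j)%O) (x : G i) :
  dirlim_in (dir_map G le_ij x) = dirlim_in x.
Proof.
apply/eqmodP/asboolP; exists j, (Order.le_refl _), le_ij.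
by rewrite /= dir_map_id.
Qed.

Fact dirlim_in_eq i j (x : G i) (y : G j) : dirlim_in x = dirlim_in y ->
  exists k (le_ik : (i <= k)%O) (le_jk : (j <= k)%O),
    dir_map G le_ik x = dir_map G le_jk y.
Proof. by move=> /eqmodP/asboolP. Qed.

Fact dirlim_inP (u : dirlim) : exists i (x : G i), u = dirlim_in x.
Proof.
elim/quotP: u => -[i x] _.
by exists i, x.
Qed.

Let ub i j := xchoose (dir_ub G i j).

Fact dirlim_ub_subproof i j : (i <= ub i j)%O * (j <= ub i j)%O.
Proof. by have /andP[] := xchooseP (dir_ub G i j). Qed.

Let mul (u v : dirlim) : dirlim :=
  let x := repr u in let y := repr v in
  let le_ub := dirlim_ub_subproof (tag x) (tag y) in
  dirlim_in (dir_map G le_ub.1 (tagged x) * dir_map G le_ub.2 (tagged y)).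
Let one : dirlim := dirlim_in (1 : G (projT1 (cid (dir_inhabited G)))).
Let inv (u : dirlim) : dirlim := dirlim_in (tagged (repr u))^-1.

Fact dirlim_in_mul i (x y : G i) : mul (dirlim_in x) (dirlim_in y) = dirlim_in (x * y).
Proof.
rewrite /mul; set u := repr (dirlim_in x); set v := repr (dirlim_in y).
have eu : dirlim_in (tagged u) = dirlim_in x.
  by rewrite -[RHS]reprK -/u; case: (u).
have ev : dirlim_in (tagged v) = dirlim_in y.
  by rewrite -[RHS]reprK -/v; case: (v).
case: (dirlim_ub_subproof _ _) => /=; set k := ub _ _ => uk vk.
have [a [ua [ia xa]]] := dirlim_in_eq eu.
have [b [vb [ib yb]]] := dirlim_in_eq ev.
have [c /andP[ac bc]] := dir_ub G a b.
have [e /andP[ce ke]] := dir_ub G c k.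
have ae := Order.le_trans ac ce; have be := Order.le_trans bc ce.
have ue := Order.le_trans ua ae; have ve := Order.le_trans vb be.
have ie := Order.le_trans ia ae.
rewrite -(dirlim_in_map ke) -(dirlim_in_map ie (x * y)) !gmulfM.
rewrite (dir_map_comp uk ke ue) (dir_map_comp vk ke ve).
rewrite -(dir_map_comp ua ae ue) xa (dir_map_comp ia ae ie).
by rewrite -(dir_map_comp vb be ve) yb (dir_map_comp ib be ie).
Qed.

Fact dirlim_in_inv i (x : G i) : inv (dirlim_in x) = dirlim_in x^-1.
Proof.
rewrite /inv; set u := repr (dirlim_in x).
have eu : dirlim_in (tagged u) = dirlim_in x.
  by rewrite -[RHS]reprK -/u; case: (u).
have [a [ua [ia xa]]] := dirlim_in_eq eu.
by rewrite -(dirlim_in_map ua) -(dirlim_in_map ia x^-1) !gmulfV xa.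
Qed.

Fact dirlim_in_one i : dirlim_in (1 : G i) = one.
Proof.
rewrite /one; set j := projT1 _; have [k /andP[ik jk]] := dir_ub G i j.
by rewrite -(dirlim_in_map ik) -(dirlim_in_map jk) !gmulf1.
Qed.

Fact dirlim_in2P (u v : dirlim) :
  exists i (x y : G i), u = dirlim_in x /\ v = dirlim_in y.
Proof.
have [[i [x ->]] [j [y ->]]] := (dirlim_inP u, dirlim_inP v).
have [k /andP[ik jk]] := dir_ub G i j.
by exists k, (dir_map G ik x), (dir_map G jk y); rewrite !dirlim_in_map.
Qed.

Fact dirlim_mulA : associative mul.
Proof.
move=> u v w; have [i [x [y [-> ->]]]] := dirlim_in2P u v.
have [j [z ->]] := dirlim_inP w; have [k /andP[ik jk]] := dir_ub G i j.
rewrite -(dirlim_in_map ik x) -(dirlim_in_map ik y) -(dirlim_in_map jk z).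
by rewrite !dirlim_in_mul mulgA.
Qed.

Fact dirlim_mul1g : left_id one mul.
Proof.
move=> u; have [i [x ->]] := dirlim_inP u.
by rewrite -(dirlim_in_one i) dirlim_in_mul mul1g.
Qed.

Fact dirlim_mulg1 : right_id one mul.
Proof.
move=> u; have [i [x ->]] := dirlim_inP u.
by rewrite -(dirlim_in_one i) dirlim_in_mul mulg1.
Qed.

Fact dirlim_mulVg : left_inverse one inv mul.
Proof.
move=> u; have [i [x ->]] := dirlim_inP u.
by rewrite dirlim_in_inv dirlim_in_mul mulVg dirlim_in_one.
Qed.

Fact dirlim_mulgV : right_inverse one inv mul.
Proof.
move=> u; have [i [x ->]] := dirlim_inP u.
by rewrite dirlim_in_inv dirlim_in_mul mulgV dirlim_in_one.
Qed.

HB.instance Definition _ := isGroup.Build dirlim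
  dirlim_mulA dirlim_mul1g dirlim_mulg1 dirlim_mulVg dirlim_mulgV.

Fact dirlim_inM i : {morph @dirlim_in i : x y / x * y}.
Proof. by move=> x y; exact: esym (dirlim_in_mul x y). Qed.

End DirectLimit.

Section FreeProduct.
Variables (I : Type) (G : I -> groupType).

Definition word : Type := {classic seq {i : I & G i}}.

HB.instance Definition _ := Choice.on word.

Let letter i (x : G i) : {i : I & G i} := Tagged (fun i => G i) x.

(* The monoid congruence on words generated by the relations of each factor. *)
Inductive word_cong : seq {i : I & G i} -> seq {i : I & G i} -> Prop :=
| word_cong_refl w : word_cong w w
| word_cong_sym w1 w2 : word_cong w1 w2 -> word_cong w2 w1
| word_cong_trans w1 w2 w3 :
    word_cong w1 w2 -> word_cong w2 w3 -> word_cong w1 w3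
| word_cong_cat w1 w1' w2 w2' :
    word_cong w1 w1' -> word_cong w2 w2' -> word_cong (w1 ++ w2) (w1' ++ w2')
| word_cong_one i : word_cong [:: letter (1 : G i)] [::]
| word_cong_mul i (x y : G i) :
    word_cong [:: letter x; letter y] [:: letter (x * y)].

Definition word_eq : rel word := fun w1 w2 => `[< word_cong w1 w2 >].

Fact word_eq_refl : reflexive word_eq.
Proof. by move=> w; apply/asboolP; exact: word_cong_refl. Qed.

Fact word_eq_sym : symmetric word_eq.
Proof. by move=> w1 w2; apply/asboolP/asboolP; exact: word_cong_sym. Qed.

Fact word_eq_trans : transitive word_eq.
Proof.
move=> w2 w1 w3 /asboolP w12 /asboolP w23; apply/asboolP.
exact: word_cong_trans w12 w23.
Qed.

Canonical word_equiv := EquivRel word_eq word_eq_refl word_eq_sym word_eq_trans.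

Definition freeprod : Type := {eq_quot word_eq}.

HB.instance Definition _ := Choice.on freeprod.
HB.instance Definition _ := Quotient.on freeprod.

Let cls (w : seq {i : I & G i}) : freeprod := \pi_freeprod (w : word).
Let winv (w : seq {i : I & G i}) := 
  rev [seq letter (tagged u)^-1 | u : {i : I & G i} <- w].
Let rep (a : freeprod) : seq {i : I & G i} := repr a.

Let mul (a b : freeprod) : freeprod := cls (rep a ++ rep b).
Let one : freeprod := cls [::].
Let inv (a : freeprod) : freeprod := cls (winv (rep a)).

Let clsP w1 w2 : cls w1 = cls w2 <-> word_cong w1 w2.
Proof. by split => [/eqmodP/asboolP|?]; last exact/eqmodP/asboolP. Qed.

Let cls_rep a : cls (rep a) = a. Proof. exact: reprK. Qed.

Let mul_cls w1 w2 : mul (cls w1) (cls w2) = cls (w1 ++ w2).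
Proof. by apply/clsP/word_cong_cat; apply/clsP; rewrite cls_rep. Qed.

Fact freeprod_mulA : associative mul.
Proof.
move=> a b c; rewrite -(cls_rep a) -(cls_rep b) -(cls_rep c).
by rewrite !mul_cls catA.
Qed.

Fact freeprod_mul1g : left_id one mul.
Proof. by move=> a; rewrite -(cls_rep a) mul_cls. Qed.

Fact freeprod_mulg1 : right_id one mul.
Proof. by move=> a; rewrite -(cls_rep a) mul_cls cats0. Qed.

Let winv_cons u w : winv (u :: w) = winv w ++ [:: letter (tagged u)^-1].
Proof. by rewrite /winv map_cons rev_cons cats1. Qed.

Let winvV w : cls (winv w ++ w) = one.
Proof.
elim: w => // -[i x] w IH; rewrite winv_cons -[RHS]IH.
rewrite -[in LHS](cat1s _ w) -catA (catA [:: _] [:: _]) -!mul_cls.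
congr (mul _ _); rewrite -[RHS]freeprod_mul1g; congr (mul _ _).
rewrite mul_cls; apply/clsP; apply: word_cong_trans (word_cong_mul _ _) _.
by rewrite mulVg; exact: word_cong_one.
Qed.

Let wVinv w : cls (w ++ winv w) = one.
Proof.
elim: w => // -[i x] w IH; rewrite winv_cons -cat1s -catA (catA w) -!mul_cls.
rewrite [mul (cls w) _]mul_cls IH freeprod_mul1g mul_cls; apply/clsP.
apply: word_cong_trans (word_cong_mul _ _) _.
by rewrite mulgV; exact: word_cong_one.
Qed.

Fact freeprod_mulVg : left_inverse one inv mul.
Proof. by move=> a; rewrite -[in RHS](winvV (rep a)) -mul_cls cls_rep. Qed.

Fact freeprod_mulgV : right_inverse one inv mul.
Proof. by move=> a; rewrite -[in RHS](wVinv (rep a)) -mul_cls cls_rep. Qed.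

HB.instance Definition _ := isGroup.Build freeprod
  freeprod_mulA freeprod_mul1g freeprod_mulg1 freeprod_mulVg freeprod_mulgV.

Fact freeprod_piM (w1 w2 : word) :
  \pi_freeprod (w1 ++ w2 : word) = \pi_freeprod w1 * \pi_freeprod w2.
Proof. exact: esym (mul_cls w1 w2). Qed.

End FreeProduct.

HB.mixin Record isConjClosed (G : groupType) (S : {pred G}) := {
  gpredJ_closed : forall x y : G, x \in S -> x ^ y \in S
}.

#[short(type="normalClosed")]
HB.structure Definition NormalClosed (G : groupType) :=
  {S of isConjClosed G S & GroupClosed G S}.

Section Quotient.
Variables (G : groupType) (N : normalClosed G).

Definition coset_eq : rel G := fun x y => x^-1 * y \in N.

Fact coset_eq_refl : reflexive coset_eq.
Proof. by move=> x; rewrite /coset_eq mulVg gpred1. Qed.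

Fact coset_eq_sym : symmetric coset_eq.
Proof. by move=> x y; rewrite /coset_eq -gpredV invgM invgK. Qed.

Fact coset_eq_trans : transitive coset_eq.
Proof.
move=> y x z xy yz; rewrite /coset_eq -[z](mulVKg y) mulgA.
exact: gpredM.
Qed.

Canonical coset_equiv :=
  EquivRel coset_eq coset_eq_refl coset_eq_sym coset_eq_trans.

Definition quot : Type := {eq_quot coset_eq}.

HB.instance Definition _ := Choice.on quot.
HB.instance Definition _ := Quotient.on quot.

Let cls (x : G) : quot := \pi_quot x.
Let mul (a b : quot) : quot := cls (repr a * repr b).
Let one : quot := cls 1.
Let inv (a : quot) : quot := cls (repr a)^-1.

Let clsP x y : cls x = cls y <-> x^-1 * y \in N.
Proof. by split => [/eqmodP|?]; last exact/eqmodP. Qed.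

Let cls_repr a : cls (repr a) = a. Proof. exact: reprK. Qed.

Let mul_cls x y : mul (cls x) (cls y) = cls (x * y).
Proof.
set x' := repr (cls x); set y' := repr (cls y); apply/clsP.
have xN : x'^-1 * x \in N by apply/clsP; exact: cls_repr.
have yN : y'^-1 * y \in N by apply/clsP; exact: cls_repr.
rewrite invgM -/x' -/y'.
have -> : y'^-1 * x'^-1 * (x * y) = (x'^-1 * x) ^ y' * (y'^-1 * y).
  by rewrite /conjg !mulgA mulgK.
by rewrite gpredM // gpredJ_closed.
Qed.

Let inv_cls x : inv (cls x) = cls x^-1.
Proof.
set x' := repr (cls x); apply/clsP.
have xN : x^-1 * x' \in N by apply/clsP; rewrite cls_repr.
rewrite invgK -/x'; have -> : x' * x^-1 = (x^-1 * x') ^ x^-1.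
  by rewrite /conjg invgK !mulgA mulgV mul1g.
exact: gpredJ_closed.
Qed.

Fact quot_mulA : associative mul.
Proof.
move=> a b c; rewrite -(cls_repr a) -(cls_repr b) -(cls_repr c).
by rewrite !mul_cls mulgA.
Qed.

Fact quot_mul1g : left_id one mul.
Proof. by move=> a; rewrite -(cls_repr a) mul_cls mul1g. Qed.

Fact quot_mulg1 : right_id one mul.
Proof. by move=> a; rewrite -(cls_repr a) mul_cls mulg1. Qed.

Fact quot_mulVg : left_inverse one inv mul.
Proof. by move=> a; rewrite -(cls_repr a) inv_cls mul_cls mulVg. Qed.

Fact quot_mulgV : right_inverse one inv mul.
Proof. by move=> a; rewrite -(cls_repr a) inv_cls mul_cls mulgV. Qed.

HB.instance Definition _ := isGroup.Build quot
  quot_mulA quot_mul1g quot_mulg1 quot_mulVg quot_mulgV.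

Fact quot_piM : {morph (\pi_quot : G -> quot) : x y / x * y}.
Proof. by move=> x y; exact: esym (mul_cls x y). Qed.

End Quotient.

(* Main.v *)
Require Import Defs.
From HB Require Import structures.
From mathcomp Require Import all_boot all_order all_algebra fingroup perm.
From mathcomp Require Import finmap boolp classical_sets reals.
From mathcomp Require Import lra.

(** Everything is done with densities. An element of the group acts up to small
    error on a finite set, and a set of exceptional points is controlled only
    through its density, so every estimate is a union bound. Approximate
    actions by maps can be replaced by approximate actions by permutations
    ([sofic_perm]); then a bad set may also be pulled back along the action
    without growing, which is what makes long products controllable.

    Products, subgroups and both limits are instances of one principle
    ([sofic_local]): it is enough that each nontrivial element of a finite set
    survives in some map to a sofic group that is multiplicative on that finite
    set. The witnesses, one for each nontrivial element, are put together on
    the product of their finite sets, where a point that moves in one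
    coordinate moves. In a direct limit the map is not a homomorphism: it lifts
    a finite part of the limit to one late enough stage.

    For a free product, take one approximate action by permutations of the
    direct product of the factors on a finite set [A]; restricted to each
    factor it is an approximate action of that factor. Put [X := A * Y] and let
    the letters of the factor [j] act on the [A] coordinate of [X] after
    a relabelling of [X] by a permutation [T j]. Relabelling changes no
    density, so the letters satisfy the relations of the factors up to a small
    error, and congruent words act almost equally ([near_word_cong]). What
    remains is to choose [T] so that a reduced word of bounded length moves
    each point on whose trajectory no single letter stands still. This is a
    large girth condition on the hypergraph in which the [j]-edges are the
    blocks on which the letters of [j] act. The girth is raised one unit at a time by passing
    to a cover with group (Z/2)^(J * X), in which walking along a [j]-edge from
    [x] to [x'] flips the bits [(j, x)] and [(j, x')] ([cover_free]).

    For an extension of [N] by an amenable quotient, take a Folner set [K] of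
    the quotient and an approximate action of [N] on [B]. On [K * B] the group acts
    by the formula for the induced action, with the cocycle of a section of the
    quotient map; the formula fails only over the few
    points of [K] that are translated out of [K] ([sofic_by_amenable]).
    The Folner sets come from the invariant mean as follows. If no finite [X]
    were almost invariant, then for some finite [S] one would have
    [2 * #|X| <= #|S X|] for all finite [X]; the marriage theorem for infinite
    families of finite sets ([hall]) then gives an injective map
    [Q * bool -> Q] given by left translations on finitely many pieces, hence
    two disjoint copies of [Q] inside [Q], of mean 1 each, which is absurd
    ([amenable_no_doubling], [folner]). *)

Set Implicit Arguments.
Unset Strict Implicit.
Unset Printing Implicit Defensive.
Import Order.TTheory GRing.Theory Num.Theory.
Local Open Scope group_scope.

(** * Densities of subsets of a finite set *)

Section Density.
Variable R : realType.
Local Open Scope ring_scope.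
Implicit Types A B : finType.

Definition density A (P : A -> bool) : R := #|[pred a | P a]|%:R / #|A|%:R.

Lemma density_sub A (P Q : A -> bool) :
  (forall a, P a -> Q a) -> density P <= density Q.
Proof.
move=> PQ; rewrite ler_wpM2r ?invr_ge0 // ler_nat subset_leq_card //.
by apply/fintype.subsetP => a; rewrite !inE; exact: PQ.
Qed.

Lemma density_cover A (P Q1 Q2 : A -> bool) :
  (forall a, P a -> Q1 a || Q2 a) -> density P <= density Q1 + density Q2.
Proof.
move=> PQ; apply: (le_trans (density_sub PQ)).
rewrite -mulrDl ler_wpM2r ?invr_ge0 // -natrD ler_nat.
rewrite -cardUI; apply: leq_trans (leq_addr _ _); apply: eq_leq.
exact: eq_card.
Qed.

Lemma density_neq_trans A (T : eqType) (g f h : A -> T) :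
  density (fun a => f a != h a) <=
  density (fun a => f a != g a) + density (fun a => g a != h a).
Proof.
apply: density_cover => a; apply: contraR; rewrite negb_or !negbK.
by move=> /andP[/eqP-> ].
Qed.

Lemma density_eq0 A (P : A -> bool) : (forall a, ~~ P a) -> density P = 0.
Proof.
move=> nP; rewrite /density eq_card0 ?mul0r // => a.
by rewrite !inE; exact: negbTE.
Qed.

Lemma density_compl A (P : A -> bool) :
  (0 < #|A|)%N -> density (fun a => ~~ P a) = 1 - density P.
Proof.
move=> A_gt0; have A_neq0 : #|A|%:R != 0 :> R by rewrite pnatr_eq0 -lt0n.
apply/(canRL (addrK _)); rewrite -mulrDl -natrD addnC.
by rewrite (cardC [pred a | P a]) divff.
Qed.

Lemma density_perm A (p : {perm A}) (P : A -> bool) :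
  density (fun a => P (p a)) = density P.
Proof.
rewrite /density; congr (_%:R / _).
rewrite -(card_image (@perm_inj _ p) [pred a | P (p a)]).
apply: eq_card => a; rewrite !inE -[a in LHS](permKV p).
by rewrite fintype.mem_image ?inE ?permKV //; exact: perm_inj.
Qed.

Lemma density_fst A B (P : A * B -> bool) (Q : A -> bool) :
  (forall a b, P (a, b) -> Q a) -> density P <= density Q.
Proof.
move=> PQ; apply: (@le_trans _ _ (density (fun x : A * B => Q x.1))).
  by apply: density_sub => -[a b]; exact: PQ.
rewrite /density card_prod.
have -> : #|[pred x : A * B | Q x.1]| = (#|[pred a | Q a]| * #|B|)%N.
  by rewrite -cardX; apply: eq_card => -[a b]; rewrite !inE andbT.
have [->|B_gt0] := posnP #|B|; first by rewrite !muln0 mul0r divr_ge0.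
by rewrite !natrM -mulf_div divff ?mulr1 // pnatr_eq0 -lt0n.
Qed.

Lemma density_snd A B (P : A * B -> bool) (Q : B -> bool) :
  (forall a b, P (a, b) -> Q b) -> density P <= density Q.
Proof.
move=> PQ; apply: (@le_trans _ _ (density (fun x : A * B => Q x.2))).
  by apply: density_sub => -[a b]; exact: PQ.
rewrite /density card_prod.
have -> : #|[pred x : A * B | Q x.2]| = (#|A| * #|[pred b | Q b]|)%N.
  by rewrite -cardX; apply: eq_card => -[a b]; rewrite !inE.
have [->|A_gt0] := posnP #|A|; first by rewrite !mul0n mul0r divr_ge0.
by rewrite !natrM -mulf_div divff ?mul1r // pnatr_eq0 -lt0n.
Qed.

Lemma density_prod A B (P : A * B -> bool) (Q1 : A -> bool) (Q2 : B -> bool) :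
  (forall a b, P (a, b) -> Q1 a || Q2 b) ->
  density P <= density Q1 + density Q2.
Proof.
move=> PQ; apply: (@le_trans _ _ (density (fun x : A * B => Q1 x.1) +
                                  density (fun x : A * B => Q2 x.2))).
  by apply: density_cover => -[a b]; exact: PQ.
by apply: lerD; [apply: density_fst | apply: density_snd].
Qed.

Lemma density_fiber A B (P : A * B -> bool) (c : R) : 0 <= c ->
  (forall a, density (fun b => P (a, b)) <= c) -> density P <= c.
Proof.
move=> c_ge0 Pc; rewrite /density card_prod.
have [B0|B_gt0] := posnP #|B|; first by rewrite B0 muln0 invr0 mulr0.
have [A0|A_gt0] := posnP #|A|; first by rewrite A0 mul0n invr0 mulr0.
rewrite ler_pdivrMr ?ltr0n ?muln_gt0 ?A_gt0 //.
have -> : #|[pred x | P x]| = (\sum_(a : A) #|[pred b | P (a, b)]|)%N.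
  rewrite -sum1_card (eq_bigl (fun x : A * B => P (x.1, x.2))); last by case.
  rewrite -(pair_big_dep xpredT (fun a b => P (a, b)) (fun _ _ => 1%N)) /=.
  by apply: eq_bigr => a _; rewrite -sum1_card; apply: eq_bigl.
rewrite natr_sum natrM mulrCA mulr_natl -sumr_const; apply: ler_sum => a _.
by rewrite -ler_pdivrMr ?ltr0n //; exact: Pc.
Qed.

End Density.

(** * Almost actions *)

Section AlmostAction.
Variable R : realType.

(** Unlike the quasi-actions of the definition of soficity, this bounds the
    density of fixed points by a weak inequality, so that all three clauses have
    the same form and are monotone in [eps], with no upper bound on [eps]. *)
Definition almost_action (G : groupType) (F : {fset G}) (eps : R)
    (A : finType) (phi : G -> A -> A) : Prop :=
  [/\ {in F &, forall e f,
         density R (fun a => phi (e * f)%g a != phi f (phi e a)) <= eps}%R,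
      (density R (fun a => phi 1%g a != a) <= eps)%R
    & {in F, forall e, e != 1%g ->
         density R (fun a => phi e a == a) <= eps}%R].

Lemma almost_action_sub (G : groupType) (F F' : {fset G}) (eps eps' : R)
    (A : finType) (phi : G -> A -> A) :
  (F `<=` F')%fset -> (eps' <= eps)%R ->
  almost_action F' eps' phi -> almost_action F eps phi.
Proof.
move=> /fsubsetP FF' le_eps [mulP oneP freeP]; split=> [e f eF fF||e eF e1].
- by apply: le_trans le_eps; apply: mulP; exact: FF'.
- exact: le_trans le_eps.
by apply: le_trans le_eps; apply: freeP => //; exact: FF'.
Qed.

Lemma similarE (A : finType) (eps : R) (e f : A -> A) : (0 < #|A|)%N ->
  Defs.similar eps e f = (density R (fun a => e a != f a) <= eps)%R.
Proof. by move=> A_gt0; rewrite /Defs.similar /density ler_pdivrMr ?ltr0n. Qed.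

(** On an empty set all maps are similar, so a quasi-action on it forces all
    elements of [F] to be trivial, and a one-point set can be used instead.
    Hence one may always ask for a nonempty set, on which similarity is a
    statement about densities. *)
Lemma soficP (G : groupType) :
  sofic R G <-> forall (F : {fset G}) (eps : R), (0 < eps)%R ->
    exists (A : finType) (phi : G -> A -> A),
      (0 < #|A|)%N /\ almost_action F eps phi.
Proof.
split=> [sG F eps eps_gt0|sG eps F /andP[eps_gt0 eps_lt1]].
  (* any constant in (0, 1) may replace 1/2 here: [eps] itself can exceed 1 *)
  have [|A [phi [mulP oneP freeP]]] := sG (Num.min eps 2^-1)%R F.
    by rewrite lt_min eps_gt0 invr_gt0 ltr0n gt_min invf_lt1 ?ltr1n ?orbT.
  have min_le : (Num.min eps 2^-1 <= eps)%R by rewrite ge_min lexx.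
  have [A0|A_gt0] := posnP #|A|; last first.
    exists A, phi; split=> //; split=> [e f eF fF||e eF e1].
    - by apply: le_trans min_le; have := mulP e f eF fF; rewrite similarE.
    - by apply: le_trans min_le; move: oneP; rewrite similarE.
    apply: le_trans min_le; have := freeP e eF e1.
    by rewrite /different similarE // density_compl // -ltNge ltrD2l ltrN2 => /ltW.
  have F1 e : e \in F -> e != 1 -> False.
    move=> eF e1; have := freeP e eF e1.
    rewrite /different /Defs.similar A0 mulr0 eq_card0 ?lexx // => a.
    by move: (fintype0 a).
  exists unit, (fun=> id); split; first by rewrite card_unit.
  split=> [e f eF fF||e eF e1].
  - by rewrite density_eq0 ?ltW // => a; rewrite eqxx.
  - by rewrite density_eq0 ?ltW // => a; rewrite eqxx.
  by case: (F1 e eF e1).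
have e2_gt0 : (0 < eps / 2)%R by rewrite divr_gt0 ?ltr0n.
have [A [phi [A_gt0 [mulP oneP freeP]]]] := sG F _ e2_gt0.
have le2 : (eps / 2 < eps)%R by lra.
exists A, phi; split=> [e f eF fF||e eF e1].
- by rewrite similarE // ltW // (le_lt_trans (mulP e f eF fF)).
- by rewrite similarE // ltW // (le_lt_trans oneP).
rewrite /different similarE // density_compl // -ltNge ltrD2l ltrN2.
exact: le_lt_trans (freeP e eF e1) le2.
Qed.

End AlmostAction.

(** * Products, subgroups and limits *)

Section LocallySofic.
Variable R : realType.

(** The finite sets attached to the nontrivial elements of [F] are multiplied
    together. The errors of the factors add up, so [d] is [eps] divided by one
    more than the largest number of factors; the fixed points of an element on
    the product lie over its fixed points on its own factor. *)
Lemma sofic_local (G : groupType) :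
  (forall (F : {fset G}) (e : G), e \in F -> e != 1 ->
     exists (H : groupType) (pi : G -> H),
       [/\ sofic R H, {in F &, {morph pi : x y / x * y}} & pi e != 1]) ->
  sofic R G.
Proof.
move=> locG; apply/soficP => F0 eps eps_gt0.
(* Having 1 in [F] makes each [pi] preserve 1, by cancellation in [H]. *)
pose F := (1 |` F0)%fset.
suff [A [phi [A_gt0 phiP]]] : exists (A : finType) (phi : G -> A -> A),
    (0 < #|A|)%N /\ almost_action F eps phi.
  exists A, phi; split=> //; apply: almost_action_sub phiP => //.
  by rewrite fsubsetUr.
set n := size (enum_fset F); pose d := (eps / n.+1%:R)%R.
have d_gt0 : (0 < d)%R by rewrite divr_gt0.
suff [A [phi [A_gt0 mulP oneP freeP]]] : exists (A : finType) (phi : G -> A -> A),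
    [/\ (0 < #|A|)%N,
        {in F &, forall e f, density R
           (fun a => phi (e * f)%g a != phi f (phi e a)) <= n%:R * d}%R,
        (density R (fun a => phi 1%g a != a) <= n%:R * d)%R
      & {in enum_fset F, forall e, e != 1%g ->
           density R (fun a => phi e a == a) <= d}%R].
  have nd : (n%:R * d <= eps)%R.
    by rewrite mulrCA ger_pMr // ler_pdivrMr ?ltr0n // mul1r ler_nat.
  have d_le : (d <= eps)%R by rewrite ger_pMr // invf_le1 ?ler1n.
  exists A, phi; split=> //; split=> [e f eF fF||e eF e1].
  - exact: le_trans (mulP e f eF fF) nd.
  - exact: le_trans nd.
  exact: le_trans (freeP e eF e1) d_le.
rewrite /n; have : {subset enum_fset F <= F} by [].
elim: (enum_fset F) => [_|e s IHs sF].
  exists unit, (fun=> id); split; first by rewrite card_unit.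
  - by move=> e f _ _; rewrite density_eq0 ?mul0r // => a; rewrite eqxx.
  - by rewrite density_eq0 ?mul0r // => a; rewrite eqxx.
  - by [].
have [x xs|A [phi [A_gt0 mulP oneP freeP]]] := IHs.
  by apply: sF; rewrite inE xs orbT.
have [e1|e1] := eqVneq e 1.
  exists A, phi; split=> //.
  - move=> x y xF yF; apply: le_trans (mulP x y xF yF) _.
    by rewrite ler_wpM2r ?ler_nat // ltW.
  - by apply: le_trans oneP _; rewrite ler_wpM2r ?ler_nat // ltW.
  - by move=> x; rewrite inE => /predU1P[->|/freeP//]; rewrite e1 eqxx.
have eF : e \in F by apply: sF; rewrite inE eqxx.
have [H [pi [sH piM pie]]] := locG F e eF e1.
have F1 : 1 \in F by rewrite !inE eqxx.
have pi1 : pi 1 = 1.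
  by apply: (mulgI (pi 1)); rewrite -piM // !mulg1.
have /soficP/(_ (pi @` F)%fset d d_gt0) [B [psi [B_gt0 [mulQ oneQ freeQ]]]] := sH.
exists (A * B)%type, (fun g x => (phi g x.1, psi (pi g) x.2)); split.
- by rewrite card_prod muln_gt0 A_gt0.
- move=> x y xF yF; rewrite /= -natr1 mulrDl mul1r.
  have [pix piy] := (in_imfset imfset_key pi xF, in_imfset imfset_key pi yF).
  apply: le_trans (lerD (mulP x y xF yF) (mulQ (pi x) (pi y) pix piy)).
  by apply: density_prod => a b /=; rewrite xpair_eqE negb_and -piM.
- rewrite /= -natr1 mulrDl mul1r; apply: le_trans (lerD oneP oneQ).
  by apply: density_prod => a b /=; rewrite xpair_eqE negb_and pi1.
move=> x; rewrite inE => /predU1P[->|xs] x1.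
  apply: le_trans (freeQ _ (in_imfset _ _ eF) pie).
  by apply: density_snd => a b /=; rewrite xpair_eqE => /andP[].
apply: le_trans (freeP x xs x1).
by apply: density_fst => a b /=; rewrite xpair_eqE => /andP[].
Qed.

Lemma sofic_residual (G : groupType) :
  (forall e : G, e != 1 -> exists (H : groupType) (pi : {ghom G -> H}),
     sofic R H /\ pi e != 1) ->
  sofic R G.
Proof.
move=> resG; apply: sofic_local => F e _ /resG[H [pi [sH pie]]].
by exists H, pi; split=> // x y _ _; exact: gmulfM.
Qed.

Section Factor.
Variables (I : Type) (G : I -> groupType) (i : I).
Definition dprod_proj (x : dprod G) : G i := x i.
Fact dprod_projM : {morph dprod_proj : x y / x * y}. Proof. by []. Qed.
HB.instance Definition _ := isMultiplicative.Build _ _ dprod_proj dprod_projM.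
Fact dprod_proj1 : dprod_proj 1 = 1. Proof. by []. Qed.
HB.instance Definition _ :=
  Multiplicative_isUMagmaMorphism.Build _ _ dprod_proj dprod_proj1.
End Factor.

Lemma sofic_dprod (I : Type) (G : I -> groupType) :
  (forall i, sofic R (G i)) -> sofic R (dprod G).
Proof.
move=> sG; apply: sofic_residual => e e1.
have [i ei] : exists i, e i != 1.
  apply: contrapT => /forallNP e_1; move/eqP: e1; apply.
  by apply: functional_extensionality_dep => i; apply/eqP/negPn/negP/e_1.
by exists (G i), (@dprod_proj I G i).
Qed.

Lemma sofic_subgrp (G : groupType) (S : groupClosed G) :
  sofic R G -> sofic R (subgrp S).
Proof.
move=> sG; apply: sofic_residual => e e1; exists G, (\val : {ghom subgrp S -> G}).
by split=> //; rewrite gmulf_eq1 //; exact: val_inj.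
Qed.

Lemma sofic_invlim (d : Order.disp_t) (I : preorderType d)
    (G : inverse_system I) :
  (forall i : I, sofic R (G i)) -> sofic R (invlim G).
Proof.
move=> /sofic_dprod sG; apply: sofic_residual => e e1.
exists (dprod G), (\val : {ghom invlim G -> dprod G}).
by split=> //; rewrite gmulf_eq1 //; exact: val_inj.
Qed.

Lemma directed_eventually (d : Order.disp_t) (I : preorderType d)
    (T : eqType) (s : seq T) (P : T -> I -> Prop) :
  (exists i : I, True) -> (forall i j : I, exists k, (i <= k)%O && (j <= k)%O) ->
  (forall t, t \in s -> exists i, forall j, (i <= j)%O -> P t j) ->
  exists i, forall j, (i <= j)%O -> forall t, t \in s -> P t j.
Proof.
move=> I0 ub; elim: s => [_|t s IHs Ps]; first by case: I0 => i _; exists i.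
have [u us|i Pi] := IHs; first by apply: Ps; rewrite inE us orbT.
have [|j Pj] := Ps t; first by rewrite inE eqxx.
have [k /andP[ik jk]] := ub i j; exists k => l kl u.
rewrite inE => /predU1P[->|us]; first by apply: Pj; exact: le_trans kl.
by apply: Pi us; exact: le_trans kl.
Qed.

(** Only finitely many elements and products are concerned. They all have
    representatives at a common stage [i], and each of the finitely many
    equations between representatives holds from some stage on: the partial
    section of the limit becomes multiplicative at a stage [l] after [i]. *)
Lemma sofic_dirlim (d : Order.disp_t) (I : preorderType d)
    (G : directed_system I) :
  (forall i : I, sofic R (G i)) -> sofic R (dirlim G).
Proof.
move=> sG; apply: sofic_local => F e eF e1.
pose F2 : {fset dirlim G} := (F `|` [fset x * y | x in F, y in F])%fset.
have [|i Hi] := @directed_eventually _ I _ (enum_fset F2)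
    (fun u i => exists x : G i, u = dirlim_in x) (dir_inhabited G) (dir_ub G).
  move=> u _; have [i [x ->]] := dirlim_inP u; exists i => j ij.
  by exists (dir_map G ij x); rewrite dirlim_in_map.
pose lift (u : dirlim G) : G i := xget 1 [set x : G i | u = dirlim_in x]%classic.
have liftK u : u \in F2 -> dirlim_in (lift u) = u.
  by move=> /(Hi i (le_refl i)) [x ux]; rewrite /lift; case: xgetP => // /(_ x).
have [|k Hk] := @directed_eventually _ I _
    (enum_fset (F `*` F)%fset)
    (fun p k => forall ik : (i <= k)%O,
      dir_map G ik (lift (p.1 * p.2)) = dir_map G ik (lift p.1 * lift p.2))
    (dir_inhabited G) (dir_ub G).
  move=> [x y]; rewrite in_fsetM /= => /andP[xF yF].
  have : dirlim_in (lift (x * y)) = dirlim_in (lift x * lift y).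
    rewrite dirlim_inM !liftK //.
    - by rewrite !inE yF.
    - by rewrite !inE xF.
    by rewrite !inE; apply/orP; right; apply: in_imfset2.
  move=> /dirlim_in_eq[k [ik [ik' eqk]]]; exists k => l kl il.
  rewrite -!(dir_map_comp ik kl il) eqk.
  by congr (dir_map G kl (dir_map G _ _)); exact: bool_irrelevance.
have [l /andP[il kl]] := dir_ub G i k.
exists (G l), (fun u => dir_map G il (lift u)); split=> // [x y xF yF|].
  have /(Hk l kl _)/(_ il)/= : (x, y) \in (F `*` F)%fset by rewrite in_fsetM xF.
  by rewrite gmulfM.
apply: contra_neq e1 => /(congr1 (@dirlim_in _ _ G l)).
by rewrite dirlim_in_map liftK ?inE ?eF // => ->; rewrite dirlim_in_one.
Qed.

End LocallySofic.

(** [f] is injective on the set of points that [h] brings back, and an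
    injection from a subset of a finite set into the set extends to a
    permutation. The permutation is corrected by a transposition at each new
    point, which leaves the values already fixed untouched. *)
Lemma perm_extension (A : finType) (f h : A -> A) :
  exists p : {perm A}, forall a, h (f a) = a -> p a = f a.
Proof.
suff [p pP] : exists p : {perm A},
    forall a, a \in [seq a <- enum A | h (f a) == a] -> p a = f a.
  by exists p => a /eqP fa; apply: pP; rewrite mem_filter fa mem_enum.
have : all (fun a => h (f a) == a) [seq a <- enum A | h (f a) == a].
  exact: filter_all.
have : uniq [seq a <- enum A | h (f a) == a] by rewrite filter_uniq ?enum_uniq.
elim: [seq a <- enum A | h (f a) == a] => [|a s IHs] /=; first by exists 1%g.
move=> /andP[as_ us] /andP[/eqP fa hs]; have [p pP] := IHs us hs.
exists (p * tperm (p a) (f a))%g => b; rewrite inE permM => /predU1P[->|bs].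
  by rewrite tpermL.
have ba : b != a by apply: contraNneq as_ => <-.
have fb : h (f b) = b by apply/eqP/(allP hs).
rewrite -(pP b bs) tpermD ?(inj_eq perm_inj) // 1?eq_sym //.
by rewrite pP //; apply: contra_neq ba; congruence.
Qed.

(** * Almost actions by permutations *)

Section Permutations.
Variable R : realType.

(** The product of [phi g] and [phi g^-1] is close to the identity, so [phi g]
    coincides with a permutation outside a set of density at most [2 * d]. In
    the bound for a product the three replaced maps cost [2 * d] each, and the
    original error is [d], whence the 7. *)
Lemma sofic_perm (G : groupType) (F : {fset G}) (eps : R) :
  sofic R G -> (0 < eps)%R ->
  exists (A : finType) (phi : G -> {perm A}),
    (0 < #|A|)%N /\ almost_action F eps (fun g => phi g).
Proof.
move=> /soficP sG eps_gt0; set d := (eps / 7)%R.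
have d_gt0 : (0 < d)%R by rewrite divr_gt0.
pose F1 : {fset G} := (1 |` (F `|` [fset x * y | x in F, y in F]))%fset.
pose F2 : {fset G} := (F1 `|` [fset x^-1 | x in F1])%fset.
have [A [phi [A_gt0 [mulP oneP freeP]]]] := sG F2 d d_gt0.
have /choice[p pP] : forall g, exists p : {perm A},
    forall a, phi g^-1 (phi g a) = a -> p a = phi g a.
  by move=> g; exact: perm_extension.
have pE g : g \in F1 -> (density R (fun a => p g a != phi g a) <= 2 * d)%R.
  move=> gF; rewrite mulr_natl mulr2n.
  have gF2 : g \in F2 by rewrite inE gF.
  have gVF2 : g^-1 \in F2 by rewrite inE [X in _ || X]in_imfset ?orbT.
  have := mulP g g^-1 gF2 gVF2; rewrite mulgV => H.
  apply: le_trans (lerD H oneP); apply: density_cover => a.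
  apply: contraR; rewrite negb_or !negbK => /andP[/eqP e1 /eqP e2].
  by apply/eqP/pP; rewrite -e1 e2.
have sF1 e : e \in F -> e \in F1 by move=> eF; rewrite !inE eF orbT.
exists A, p; split=> //; split=> [e f eF fF||e eF e1].
- have efF1 : e * f \in F1.
    by rewrite !inE; apply/orP; right; apply/orP; right; exact: in_imfset2.
  have eF2 : e \in F2 by rewrite inE sF1.
  have fF2 : f \in F2 by rewrite inE sF1.
  have pfE := pE f (sF1 f fF); rewrite -(density_perm R (p e)) in pfE.
  have -> : eps = (2 * d + (d + (2 * d + 2 * d)))%R by rewrite /d; lra.
  apply: le_trans (density_neq_trans _ (fun a => phi (e * f) a) _ _) _.
  apply: lerD (pE _ efF1) _.
  apply: le_trans (density_neq_trans _ (fun a => phi f (phi e a)) _ _) _.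
  apply: lerD (mulP e f eF2 fF2) _; apply: le_trans (lerD (pE e (sF1 e eF)) pfE).
  apply: density_cover => a; apply: contraR; rewrite negb_or !negbK.
  by move=> /andP[/eqP <- /eqP <-].
- have -> : eps = (2 * d + 5 * d)%R by rewrite /d; lra.
  apply: le_trans (density_neq_trans _ (fun a => phi 1 a) _ _) (lerD _ _).
    by apply: pE; rewrite !inE eqxx.
  by apply: le_trans oneP _; lra.
have -> : eps = (2 * d + 5 * d)%R by rewrite /d; lra.
have eF2 : e \in F2 by rewrite inE sF1.
apply: le_trans (lerD (pE e (sF1 e eF)) _); last first.
  by apply: le_trans (freeP e eF2 e1) _; lra.
apply: density_cover => a; apply: contraTT; rewrite negb_or negbK.
by move=> /andP[/eqP ->].
Qed.
End Permutations.

(** * Free actions of words of bounded length *)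

Section Girth.
Variables J A : finType.

Section LetterAction.
Variables (Y : finType) (T : J -> {perm A * Y}).

Fact act_fst_inj (p : {perm A}) : injective (fun x : A * Y => (p x.1, x.2)).
Proof. by move=> [a y] [b z] /= [/perm_inj-> ->]. Qed.

Definition act_fst (p : {perm A}) : {perm A * Y} := perm (act_fst_inj (p := p)).

(** Permutations multiply from left to right, so this is [act_fst l.2] read
    through the relabelling [T l.1] of [A * Y]. *)
Definition letter_act (l : J * {perm A}) : {perm A * Y} :=
  T l.1 * act_fst l.2 * (T l.1)^-1.

Definition word_act (w : seq (J * {perm A})) : {perm A * Y} :=
  \prod_(l <- w) letter_act l.

Lemma word_act_cons l w x : word_act (l :: w) x = word_act w (letter_act l x).
Proof. by rewrite /word_act big_cons permM. Qed.

(** A trajectory with a step that stands still may backtrack and close up. Such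
    starting points are given up: their density is bounded by the densities of
    the fixed points of the single letters ([density_stalls]). *)
Fixpoint stalls (w : seq (J * {perm A})) (x : A * Y) : bool :=
  if w is l :: w' then (letter_act l x == x) || stalls w' (letter_act l x)
  else false.

Lemma stalls_take m w x : stalls (take m w) x -> stalls w x.
Proof.
elim: w m x => [|l w IHw] [|m] x //= /orP[->//|/IHw->]; exact: orbT.
Qed.

End LetterAction.

Definition reduced_letters : rel (J * {perm A}) := fun l m => l.1 != m.1.

Definition free_upto (n : nat) (Y : finType) (T : J -> {perm A * Y}) : Prop :=
  forall w x, sorted reduced_letters w -> (0 < size w <= n)%N ->
    ~~ stalls T w x -> word_act T w x != x.

Section DoubleCover.
Variables (Y : finType) (T : J -> {perm A * Y}).

Let V : finType := {ffun J * (A * Y) -> bool}.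

(** The fibre of the cover is the group of bit vectors indexed by pairs of
    a colour and a point; [flip v k] is [v] plus the basis vector at [k]. *)
Definition flip (v : V) (k : J * (A * Y)) : V := [ffun l => v l (+) (l == k)].

Lemma flipK k : involutive (flip^~ k).
Proof. by move=> v; apply/ffunP => l; rewrite !ffunE addbK. Qed.

Definition cover_base (x : A * (Y * V)) : A * Y := (x.1, x.2.1).

(** Conjugating by this relabelling makes a [j]-letter that moves the base point
    from [x] to [z] flip the bits [(j, x)] and [(j, z)], as the computation
    [cover_letter] shows. *)
Definition cover_fun (j : J) (x : A * (Y * V)) : A * (Y * V) :=
  let z := T j (cover_base x) in (z.1, (z.2, flip x.2.2 (j, cover_base x))).

Fact cover_fun_inj j : injective (cover_fun j).
Proof.
move=> x x'; rewrite /cover_fun => -[e1 e2 e3].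
have bxx' : cover_base x = cover_base x'.
  apply: (@perm_inj _ (T j)).
  by rewrite (surjective_pairing (T j _)) e1 e2 -surjective_pairing.
move: e3; rewrite bxx' => /(can_inj (flipK _)) e3.
by case: x x' bxx' e3 {e1 e2} => [a [y v]] [a' [y' v']] /= [-> ->] ->.
Qed.

Definition cover (j : J) : {perm A * (Y * V)} := perm (@cover_fun_inj j).

Lemma cover_letter l x : let z := letter_act T l (cover_base x) in
  letter_act cover l x =
  (z.1, (z.2, flip (flip x.2.2 (l.1, cover_base x)) (l.1, z))).
Proof.
set z := letter_act T l _ => /=; rewrite /letter_act !permM.
apply: (canLR (permK _)); rewrite !permE /= /cover_fun /=.
have -> : cover_base (z.1, (z.2, flip (flip x.2.2 (l.1, cover_base x)) (l.1, z)))
   = z by rewrite /cover_base /= -surjective_pairing.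
by rewrite flipK /z /letter_act !permM permKV permE.
Qed.

Lemma cover_letter_base l x :
  cover_base (letter_act cover l x) = letter_act T l (cover_base x).
Proof. by rewrite cover_letter /cover_base /= -surjective_pairing. Qed.

Lemma cover_stalls w x : stalls T w (cover_base x) -> stalls cover w x.
Proof.
elim: w x => //= l w IHw x /orP[/eqP lx|sw]; apply/orP; last first.
  by right; apply: IHw; rewrite cover_letter_base.
left; apply/eqP; rewrite cover_letter lx flipK.
by case: x {lx} => [a [y v]].
Qed.

(** Only arrivals at [z] and departures from [z] can flip a bit at [z]. *)
Lemma cover_bit_const w x j z :
  (forall m, word_act T (take m w) (cover_base x) != z) ->
  (word_act cover w x).2.2 (j, z) = x.2.2 (j, z).
Proof.
elim: w x => [|l w IHw] x wz; first by rewrite /word_act big_nil perm1.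
have nz u : u != z -> ((j, z) == (l.1, u)) = false.
  by move=> uz; rewrite xpair_eqE [z == _]eq_sym (negbTE uz) andbF.
have z0 := wz 0%N; have z1 := wz 1%N.
rewrite take0 /word_act big_nil perm1 in z0.
rewrite /= take0 /word_act big_seq1 in z1.
rewrite word_act_cons IHw => [|m]; last first.
  by rewrite cover_letter_base -word_act_cons; exact: (wz m.+1).
by rewrite cover_letter /= !ffunE !nz // !addbF.
Qed.

(** By hypothesis no trajectory of length at most [n] below closes up, so one of
    length [n.+1] never returns to the point [z] reached after its first letter.
    The bit at [z] in the colour of the first letter is flipped by the
    first letter on arriving at [z], and never again: the second letter has
    another colour, and later ones do not touch [z]. So the trajectory does not
    close up in the cover. *)
Lemma cover_free n : free_upto n T -> free_upto n.+1 cover.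
Proof.
move=> freeT [//|l1 [|l2 w]] x /=.
  by move=> _ _; rewrite orbF word_act_cons /word_act big_nil perm1.
move=> /andP[l12 sw] sz; rewrite negb_or => /andP[m1 nst].
apply/negP => /eqP/(congr1 (fun x => x.2.2)).
set x1 := letter_act cover l1 x in m1 nst *.
set z := cover_base x1; move=> /(congr1 (fun v : V => v (l1.1, z))).
have zx : z != cover_base x.
  apply: contraNneq m1 => zx; have : stalls cover [:: l1] x.
    by apply: cover_stalls; rewrite /= -cover_letter_base -/x1 -/z zx eqxx.
  by rewrite /= orbF.
have nstT : ~~ stalls T (l2 :: w) z by apply: contra nst => /cover_stalls.
have wz m : word_act T (l2 :: take m w) z != z.
  apply: freeT; first exact: (@take_sorted _ _ m.+1 (l2 :: w)).
    by rewrite /= size_take_min (leq_ltn_trans (geq_minr _ _)).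
  by apply: contra nstT => /(@stalls_take _ _ m.+1 (l2 :: w)).
rewrite !word_act_cons cover_bit_const => [|m]; last first.
  by rewrite cover_letter_base -word_act_cons; exact: wz.
rewrite cover_letter /= !ffunE !xpair_eqE (negbTE l12) /= !addbF.
rewrite cover_letter /= !ffunE -cover_letter_base -/x1 -/z eqxx xpair_eqE.
by rewrite (negbTE zx) andbF addbF; case: (x.2.2 _).
Qed.

End DoubleCover.

Lemma free_upto_exists n :
  exists (Y : finType) (T : J -> {perm A * Y}),
    (0 < #|Y|)%N /\ free_upto n T.
Proof.
elim: n => [|n [Y [T [Y_gt0 freeT]]]].
  exists unit, (fun=> 1%g); split; first by rewrite card_unit.
  by move=> w x _ /andP[sw]; rewrite leqNgt sw.
exists _, (cover T); split; last exact: cover_free.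
rewrite card_prod muln_gt0 Y_gt0; apply/card_gt0P.
by exists [ffun=> false].
Qed.

End Girth.

(** * Free products *)

Section LetterDensity.
Variable R : realType.
Variables (J A Y : finType) (T : J -> {perm A * Y}).
Local Open Scope ring_scope.

Lemma letter_actM j p q :
  (letter_act T (j, p) * letter_act T (j, q))%g = letter_act T (j, (p * q)%g).
Proof.
rewrite /letter_act /= !mulgA mulgKV -[(_ * _ * act_fst Y q)%g]mulgA.
congr (_ * _ * _)%g.
by apply/permP => x; rewrite !(permM, permE).
Qed.

Lemma density_letter j p q :
  density R (fun x => letter_act T (j, p) x != letter_act T (j, q) x) <=
  density R (fun a => p a != q a).
Proof.
pose Q x := act_fst Y p x != act_fst Y q x.
apply: (@le_trans _ _ (density R Q)).
  rewrite -(density_perm _ (T j) Q); apply: density_sub => x.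
  by apply: contra => /eqP; rewrite /letter_act !permM /= => ->.
by apply: density_fst => a y; rewrite /Q !permE xpair_eqE eqxx andbT.
Qed.

Lemma density_letter_fix l :
  density R (fun x => letter_act T l x == x) <=
  density R (fun a => l.2 a == a).
Proof.
pose Q x := act_fst Y l.2 x == x.
apply: (@le_trans _ _ (density R Q)).
  rewrite -(density_perm _ (T l.1) Q); apply: density_sub => x.
  by rewrite /letter_act !permM /= (canF_eq (permKV _)) => /eqP/eqP.
by apply: density_fst => a y; rewrite /Q !permE xpair_eqE eqxx andbT.
Qed.

Lemma density_stalls w :
  density R (stalls T w) <= \sum_(l <- w) density R (fun a => l.2 a == a).
Proof.
elim: w => [|l w IHw]; first by rewrite big_nil density_eq0.
rewrite big_cons; apply: le_trans (lerD (density_letter_fix l) IHw).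
rewrite -(density_perm _ (letter_act T l) (stalls T w)).
by apply: density_cover.
Qed.

End LetterDensity.

Section FreeProduct.
Variable R : realType.
Variables (I : Type) (G : I -> groupType).

Definition coord_inj i (x : G i) : dprod G := fun k =>
  if pselect (i = k) is left e then ecast k (G k) e x else 1.

Lemma coord_injE i (x : G i) : coord_inj x i = x.
Proof.
by rewrite /coord_inj; case: pselect => // e; rewrite (Prop_irrelevance e erefl).
Qed.

Lemma coord_injM i : {morph @coord_inj i : x y / x * y}.
Proof.
move=> x y; apply: functional_extensionality_dep => k.
rewrite -[RHS]/(coord_inj x k * coord_inj y k) /coord_inj.
by case: pselect => [e|_]; [case: _ / e | rewrite mulg1].
Qed.

Lemma coord_inj1 i : coord_inj (1 : G i) = 1.
Proof.
apply: (mulgI (coord_inj (1 : G i))).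
by rewrite -[LHS](coord_injM (1 : G i) 1) !mulg1.
Qed.

Lemma coord_inj_eq1 i (x : G i) : (coord_inj x == 1) = (x == 1).
Proof.
apply/eqP/eqP => [e|->]; last exact: coord_inj1.
by rewrite -(coord_injE x) e.
Qed.

(** Properties of the almost actions of the direct product by permutations that
    hold as soon as the almost action is good enough. They are closed under
    finite conjunction ([near_sofic_all]), which avoids tracking the finite sets
    and error bounds. *)
Definition near_sofic (Q : forall A : finType, (dprod G -> {perm A}) -> Prop) :=
  exists (F : {fset dprod G}) (d : R), (0 < d)%R /\
    forall (A : finType) (phi : dprod G -> {perm A}),
      almost_action F d (fun g => phi g) -> Q A phi.

Lemma near_sofic_and Q1 Q2 : near_sofic Q1 -> near_sofic Q2 ->
  near_sofic (fun A phi => Q1 A phi /\ Q2 A phi).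
Proof.
move=> [F1 [d1 [d1_gt0 H1]]] [F2 [d2 [d2_gt0 H2]]].
exists (F1 `|` F2)%fset, (Num.min d1 d2); rewrite lt_min d1_gt0 d2_gt0.
split=> // A phi phiP; split; [apply: H1|apply: H2].
  by apply: almost_action_sub phiP; rewrite ?fsubsetUl // ge_min lexx.
by apply: almost_action_sub phiP; rewrite ?fsubsetUr // ge_min lexx orbT.
Qed.

Lemma near_sofic_sub (Q1 Q2 : forall A : finType, (dprod G -> {perm A}) -> Prop) :
  (forall A phi, Q1 A phi -> Q2 A phi) -> near_sofic Q1 -> near_sofic Q2.
Proof. by move=> Q12 [F [d [d_gt0 H]]]; exists F, d; split=> // A phi /H/Q12. Qed.

Lemma near_sofic_all (T : eqType) (s : seq T) Q :
  (forall t, t \in s -> near_sofic (Q t)) ->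
  near_sofic (fun A phi => forall t, t \in s -> Q t A phi).
Proof.
elim: s => [_|t s IHs Qs]; first by exists fset0, 1%R.
have Qt : near_sofic (Q t) by apply: Qs; rewrite inE eqxx.
have {}IHs : near_sofic (fun A phi => forall t, t \in s -> Q t A phi).
  by apply: IHs => u us; apply: Qs; rewrite inE us orbT.
apply: near_sofic_sub (near_sofic_and Qt IHs) => A phi [Qt' Qs'] u.
by rewrite inE => /predU1P[->|/Qs'].
Qed.

Section Code.
Variables (J A : finType) (c : I -> J) (phi : dprod G -> {perm A}).
Definition code (u : {i : I & G i}) : J * {perm A} :=
  (c (tag u), phi (coord_inj (tagged u))).
End Code.

(** By induction on the derivation of the congruence: each relation of a factor
    costs one error of the almost action, and it stays small in the context of
    a word because the letters are permutations. The bound is uniform in the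
    relabellings [T], as they only conjugate. *)
Lemma near_word_cong (w1 w2 : seq {i : I & G i}) (eps : R) :
  word_cong w1 w2 -> (0 < eps)%R ->
  near_sofic (fun A phi => forall (J Y : finType) (c : I -> J)
    (T : J -> {perm A * Y}),
    density R (fun x => word_act T (map (code c phi) w1) x !=
                        word_act T (map (code c phi) w2) x) <= eps)%R.
Proof.
move=> w12; elim: w12 eps => {w1 w2}.
- move=> w eps eps_gt0; exists fset0, 1%R; split=> // A phi _ J Y c T.
  by rewrite density_eq0 ?ltW // => x; rewrite eqxx.
- move=> w1 w2 _ IH eps /IH; apply: near_sofic_sub => A phi H J Y c T.
  by apply: le_trans (H J Y c T); apply: density_sub => x; rewrite eq_sym.
- move=> w1 w2 w3 _ IH12 _ IH23 eps eps_gt0.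
  have e2_gt0 : (0 < eps / 2)%R by rewrite divr_gt0.
  apply: near_sofic_sub (near_sofic_and (IH12 _ e2_gt0) (IH23 _ e2_gt0)).
  move=> A phi [H12 H23] J Y c T; rewrite (splitr eps).
  apply: le_trans (lerD (H12 J Y c T) (H23 J Y c T)).
  exact: density_neq_trans.
- move=> w1 w1' w2 w2' _ IH1 _ IH2 eps eps_gt0.
  have e2_gt0 : (0 < eps / 2)%R by rewrite divr_gt0.
  apply: near_sofic_sub (near_sofic_and (IH1 _ e2_gt0) (IH2 _ e2_gt0)).
  move=> A phi [H1 H2] J Y c T; rewrite (splitr eps).
  have {}H2 := H2 J Y c T.
  rewrite -(density_perm _ (word_act T (map (code c phi) w1'))) in H2.
  apply: le_trans (lerD (H1 J Y c T) H2); apply: density_cover => x.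
  apply: contraR; rewrite negb_or !negbK => /andP[/eqP e1 /eqP e2].
  by rewrite !map_cat /word_act !big_cat !permM /= -!/(word_act _ _) e1 e2.
- move=> i eps eps_gt0; exists fset0, eps; split=> // A phi [_ oneP _] J Y c T.
  rewrite /= /word_act big_seq1 big_nil.
  have -> : (1%g : {perm A * Y}) = letter_act T (c i, 1%g).
    rewrite /letter_act /= (_ : act_fst Y 1%g = 1%g) ?mulg1 ?mulgV //.
    by apply/permP => -[a y]; rewrite perm1 permE /= perm1.
  apply: le_trans (density_letter _ _ _ _ _) _.
  apply: le_trans oneP; apply: density_sub => a.
  by rewrite /= coord_inj1 perm1.
move=> i x y eps eps_gt0.
exists [fset coord_inj x; coord_inj y]%fset, eps; split=> // A phi.
move=> [mulP _ _] J Y c T; rewrite /= /word_act big_cons !big_seq1.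
rewrite /code /= letter_actM; apply: le_trans (density_letter _ _ _ _ _) _.
apply: le_trans (mulP (coord_inj x) (coord_inj y) _ _); rewrite ?inE ?eqxx ?orbT //.
by apply: density_sub => a; rewrite permM coord_injM eq_sym.
Qed.

Definition reduced (w : seq {i : I & G i}) : bool :=
  all (fun u : {i : I & G i} => (tagged u : G (tag u)) != 1) w &&
  sorted (fun u v => ~~ `[< tag u = tag v >]) w.

(** A new first letter is dropped if it is trivial, and merged with the next
    letter if both come from the same factor; the merged letter still differs in
    factor from the one after it. *)
Lemma word_cong_reduced (w : seq {i : I & G i}) :
  exists2 w', word_cong w w' & reduced w'.
Proof.
elim: w => [|u w [w' ww' rw']]; first by exists [::]; first exact: word_cong_refl.
have cuw : word_cong (u :: w) (u :: w').
  apply: (word_cong_cat (w1 := [:: u]) (w1' := [:: u])) => //.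
  exact: word_cong_refl.
have [u1|u1] := eqVneq (tagged u : G (tag u)) 1.
  exists w' => //; apply: word_cong_trans cuw _.
  case: u u1 => i x /= ->.
  apply: (word_cong_cat (w1 := [:: _]) (w1' := [::])); last exact: word_cong_refl.
  exact: word_cong_one.
case: w' ww' rw' cuw => [|v w'] ww' rw' cuw.
  by exists [:: u]; rewrite // /reduced /= u1.
have [uv|uv] := asboolP (tag u = tag v); last first.
  exists (u :: v :: w') => //; move: rw'; rewrite /reduced /= u1 => /andP[-> ->].
  by rewrite !andbT; apply/asboolPn.
case: u v uv u1 cuw rw' {ww'} => [i x] [j y] /= ij; case: _ / ij y => y x1 cuw.
rewrite /reduced /= => /andP[/andP[y1 w1] sw].
have cxy : word_cong (existT (fun i => G i : Type) i x :: existT _ i y :: w')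
                     (existT (fun i => G i : Type) i (x * y) :: w').
  apply: (word_cong_cat (w1 := [:: _; _]) (w1' := [:: _])); last first.
    exact: word_cong_refl.
  exact: word_cong_mul.
have [xy1|xy1] := eqVneq (x * y) 1.
  exists w'; last by rewrite w1 (path_sorted sw).
  apply: word_cong_trans cuw _; apply: word_cong_trans cxy _; rewrite xy1.
  apply: (word_cong_cat (w1 := [:: _]) (w1' := [::])); last exact: word_cong_refl.
  exact: word_cong_one.
exists (existT (fun i => G i : Type) i (x * y) :: w').
  exact: word_cong_trans cuw cxy.
by rewrite /= xy1 w1 /=; case: (w') sw.
Qed.

Lemma freeprod_eqP (w1 w2 : word G) :
  \pi_(freeprod G)%qT w1 = \pi_(freeprod G)%qT w2 <-> word_cong w1 w2.
Proof. by split => [/eqmodP/asboolP|?]; last exact/eqmodP/asboolP. Qed.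

(** An element acts through the word that represents it in the quotient, which
    gives the multiplicativity up to congruence. For the fixed points it is
    compared with a congruent reduced word, which is nonempty if the element is
    nontrivial, and which fixes only points at which some letter stalls. *)
Lemma sofic_freeprod : (forall i, sofic R (G i)) -> sofic R (freeprod G).
Proof.
move=> sG; apply/soficP => F eps eps_gt0.
pose rep (g : freeprod G) : seq {i : I & G i} := generic_quotient.repr g.
have /choice[nf nfP] g : exists w, word_cong (rep g) w /\ reduced w.
  by have [w] := word_cong_reduced (rep g); exists w.
have repM e f : word_cong (rep (e * f)) (rep e ++ rep f).
  apply/(freeprod_eqP (rep (e * f)) (rep e ++ rep f)).
  by rewrite [LHS]reprK freeprod_piM; congr (_ * _); rewrite [RHS]reprK.
have rep1 : word_cong (rep 1) [::].
  by apply/(freeprod_eqP (rep 1) [::]); rewrite [LHS]reprK.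
have nf_neq0 e : e != 1 -> (0 < size (nf e))%N.
  apply: contra_neqT; case: (nf e) (nfP e) => // -[ce _] _.
  by rewrite -[LHS]reprK; apply/(freeprod_eqP (rep e) [::]).
have e2_gt0 : (0 < eps / 2)%R by rewrite divr_gt0.
have near_mul : near_sofic (fun A phi => forall p, p \in enum_fset (F `*` F)%fset ->
    forall (J Y : finType) (c : I -> J) (T : J -> {perm A * Y}),
    density R (fun x => word_act T (map (code c phi) (rep (p.1 * p.2)%g)) x !=
      word_act T (map (code c phi) (rep p.1 ++ rep p.2)) x) <= eps)%R.
  by apply: near_sofic_all => -[e f] _; exact: near_word_cong.
have near_nf : near_sofic (fun A phi => forall e, e \in enum_fset F ->
    forall (J Y : finType) (c : I -> J) (T : J -> {perm A * Y}),
    density R (fun x => word_act T (map (code c phi) (rep e)) x !=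
      word_act T (map (code c phi) (nf e)) x) <= eps / 2)%R.
  by apply: near_sofic_all => e _; apply: near_word_cong => //; case: (nfP e).
pose fixes e A (phi : dprod G -> {perm A}) : R := (\sum_(u <- nf e)
  density R (fun a => phi (coord_inj (tagged u)) a == a))%R.
have near_fix : near_sofic (fun A phi => forall e, e \in enum_fset F ->
    fixes e A phi <= eps / 2)%R.
  apply: near_sofic_all => e _; rewrite /fixes.
  have [_ /andP[]] := nfP e; elim: (nf e) (eps / 2)%R e2_gt0 => [|u w IHw] d d_gt0.
    by move=> _ _; exists fset0, 1%R; split=> // A phi _; rewrite big_nil ltW.
  rewrite /= => /andP[u1 w1] /path_sorted sw.
  have d2_gt0 : (0 < d / 2)%R by rewrite divr_gt0.
  have near_u : near_sofic (fun A phi =>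
      density R (fun a => phi (coord_inj (tagged u)) a == a) <= d / 2)%R.
    exists [fset coord_inj (tagged u)]%fset, (d / 2)%R; split=> // A phi.
    by move=> [_ _]; apply; rewrite ?inE ?eqxx // coord_inj_eq1.
  apply: near_sofic_sub (near_sofic_and near_u (IHw _ d2_gt0 w1 sw)).
  by move=> A phi [H1 H2]; rewrite big_cons (splitr d) lerD.
have near_1 := near_word_cong rep1 eps_gt0.
have [F' [d [d_gt0 H]]] := near_sofic_and (near_sofic_and near_mul near_nf)
  (near_sofic_and near_fix near_1).
have [A [phi [A_gt0 /H{H}[[mulA nfA] [fixA oneA]]]]] :=
  sofic_perm F' (sofic_dprod sG) d_gt0.
(* Finitely many factors occur; [c] colours [I] by a finite type and separates
   them. The colour [size tags] is shared by all other factors. *)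
pose tags : seq {classic I} := flatten [seq map tag (nf e) | e <- enum_fset F].
pose J : finType := 'I_(size tags).+1.
pose c (i : I) : J := inord (index (i : {classic I}) tags).
have c_inj i j : (i : {classic I}) \in tags -> c i = c j -> i = j.
  move=> it /(congr1 val); rewrite /= !inordK ?ltnS ?index_size // => ij.
  have jt : (j : {classic I}) \in tags by rewrite -index_mem -ij index_mem.
  by rewrite -[LHS](nth_index (i : {classic I}) it) ij nth_index.
have [Y [T [Y_gt0 freeT]]] :=
  free_upto_exists J A (\max_(e <- enum_fset F) size (nf e)).
exists (A * Y)%type, (fun g x => word_act T (map (code c phi) (rep g)) x).
split; first by rewrite card_prod muln_gt0 A_gt0.
split=> [e f eF fF||e eF e1].
- have := mulA (e, f) _ J Y c T; rewrite /= map_cat /word_act big_cat.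
  have ef : (e, f) \in enum_fset (F `*` F)%fset.
    by rewrite [_ \in _]in_fsetM eF.
  move=> /(_ ef); apply: le_trans; apply: density_sub => x.
  by rewrite permM.
- apply: le_trans (oneA J Y c T); apply: density_sub => x.
  by rewrite /word_act big_nil perm1.
rewrite (splitr eps); apply: le_trans (lerD (nfA e eF J Y c T) (fixA e eF)).
set w := map (code c phi) (nf e).
have -> : fixes e A phi = (\sum_(l <- w) density R (fun a => l.2 a == a))%R.
  by rewrite big_map.
apply: le_trans (lerD (lexx _) (density_stalls _ T w)).
apply: density_cover => x; apply: contraTT; rewrite negb_or negbK.
move=> /andP[/eqP -> nst]; apply: freeT => //; last first.
  rewrite size_map nf_neq0 //=.
  exact: (leq_bigmax_seq (F := fun e => size (nf e))).
have [_ /andP[_ snf]] := nfP e; rewrite sorted_map.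
apply: (sub_in_sorted (P := fun u => (tag u : {classic I}) \in tags) _ _ snf).
  move=> u v ut _; rewrite /reduced_letters /=; apply: contra => /eqP cuv.
  by apply/asboolP; exact: c_inj cuv.
rewrite -(all_map tag (fun i : {classic I} => i \in tags)).
apply/allP => i it; apply/flattenP; exists (map tag (nf e)) => //.
exact: map_f.
Qed.

End FreeProduct.

(** * The marriage theorem for infinite families of finite sets *)

Section Hall.
Variables L K : choiceType.
Implicit Types (N M : L -> {fset K}) (X : {fset L}).

Definition nbhd N X : {fset K} := (\bigcup_(x <- X) N x)%fset.

Lemma in_nbhdP N X y : reflect (exists2 x, x \in X & y \in N x) (y \in nbhd N X).
Proof.
apply: (iffP (bigfcupP _ _ _ _)) => -[x xX yx]; exists x => //; first by case/andP: xX.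
by rewrite xX.
Qed.

Definition hall_cond N : Prop := forall X, (#|` X| <= #|` nbhd N X|)%N.

Definition drop_edge N x a : L -> {fset K} :=
  fun z => if z == x then (N z `\ a)%fset else N z.

Lemma hall_cond_ext N M : N =1 M -> hall_cond N -> hall_cond M.
Proof. by move=> /funext->. Qed.

Lemma nbhdS N M X : {in X, forall x, N x `<=` M x}%fset ->
  (nbhd N X `<=` nbhd M X)%fset.
Proof.
move=> NM; apply/fsubsetP => y /in_nbhdP[x xX yx]; apply/in_nbhdP.
by exists x => //; apply: fsubsetP yx; exact: NM.
Qed.

(** If deleting the edge from [x] to [a] destroys the marriage condition, the
    violating set contains [x]; removing [x] from it gives a tight set. *)
Lemma hall_critical N x a : hall_cond N -> ~ hall_cond (drop_edge N x a) ->
  exists2 X, x \notin X & (#|` nbhd N X `|` (N x `\ a)| <= #|` X|)%fset%N.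
Proof.
move=> hallN /existsNP[X /negP]; rewrite -ltnNge => ltX.
have [xX|xX] := boolP (x \in X); last first.
  suff : (#|` nbhd N X| < #|` X|)%N by rewrite ltnNge hallN.
  apply: leq_ltn_trans ltX; apply/fsubset_leq_card/nbhdS => z zX.
  by rewrite /drop_edge; case: eqVneq zX xX => // -> ->.
exists (X `\ x)%fset; first by rewrite !inE eqxx.
move: ltX; rewrite (cardfsD1 x X) xX ltnS; apply: leq_trans.
apply/fsubset_leq_card/fsubsetP => y; rewrite inE => /orP[/in_nbhdP[z]|yx].
  rewrite !inE => /andP[zx zX] yz; apply/in_nbhdP; exists z => //.
  by rewrite /drop_edge (negbTE zx).
by apply/in_nbhdP; exists x => //; rewrite /drop_edge eqxx.
Qed.

(** Rado's argument: two tight sets, for [a] and for [b], would contradict the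
    marriage condition on their union with [x] and on their intersection, since
    cardinality is modular. *)
Lemma hall_drop_edge N x a b : hall_cond N -> a \in N x -> b \in N x -> a != b ->
  hall_cond (drop_edge N x a) \/ hall_cond (drop_edge N x b).
Proof.
move=> hallN ax bx ab; apply: contrapT => /not_orP[].
move=> /(hall_critical hallN)[X1 xX1 le1] /(hall_critical hallN)[X2 xX2 le2].
set U1 := (nbhd N X1 `|` _)%fset in le1; set U2 := (nbhd N X2 `|` _)%fset in le2.
have leU : (#|` x |` (X1 `|` X2)| <= #|` U1 `|` U2|)%fset%N.
  apply: leq_trans (hallN _) (fsubset_leq_card _); apply/fsubsetP => y.
  move=> /in_nbhdP[z]; rewrite in_fset1U => /predU1P[->|].
    by rewrite /U1 /U2 !inE => ->; case: eqVneq => [->|]; rewrite ?ab ?orbT.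
  rewrite in_fsetU /U1 /U2 !in_fsetU => /orP[] zX yz.
    by have -> : y \in nbhd N X1 by apply/in_nbhdP; exists z.
  by have -> : y \in nbhd N X2; rewrite ?orbT //; apply/in_nbhdP; exists z.
have leI : (#|` X1 `&` X2| <= #|` U1 `&` U2|)%fset%N.
  apply: leq_trans (hallN _) (fsubset_leq_card _); apply/fsubsetP => y.
  move=> /in_nbhdP[z]; rewrite in_fsetI /U1 /U2 in_fsetI !in_fsetU => /andP[z1 z2] yz.
  have -> : y \in nbhd N X1 by apply/in_nbhdP; exists z.
  by have -> : y \in nbhd N X2 by apply/in_nbhdP; exists z.
have := leq_add leU leI; rewrite cardfsUI cardfsU1 in_fsetU negb_or xX1 xX2 /=.
by rewrite -addnA cardfsUI add1n ltnNge leq_add.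
Qed.

Definition prune N (D : set (L * K)) : L -> {fset K} :=
  fun x => [fset y in N x | ~~ `[< D (x, y) >]]%fset.

Lemma in_prune N D x y : (y \in prune N D x) = (y \in N x) && ~~ `[< D (x, y) >].
Proof. by rewrite !inE. Qed.

Lemma prune_drop_edge N D x a :
  prune N ((x, a) |` D)%classic =1 drop_edge (prune N D) x a.
Proof.
move=> z; apply/fsetP => y; rewrite /drop_edge in_prune.
have -> : `[< ((x, a) |` D)%classic (z, y) >] = ((z, y) == (x, a)) || `[< D (z, y) >].
  apply/asboolP/orP => -[].
  - by move=> ->; left.
  - by move=> Dzy; right; apply/asboolP.
  - by move=> /eqP ->; left.
  by move=> /asboolP; right.
rewrite negb_or xpair_eqE; case: eqVneq => zx; rewrite ?in_fsetD1 in_prune //.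
by rewrite andbCA.
Qed.

(** A finite set [X] meets only finitely many edges, so on [X] the union of
    a chain of sets of deleted edges agrees with one of its members, or with the
    empty set if the chain is empty. *)
Lemma hall_prune_chain N (F : set (set (L * K))) : hall_cond N ->
  (forall D, F D -> hall_cond (prune N D)) -> total_on F subset ->
  hall_cond (prune N (\bigcup_(D in F) D)%classic).
Proof.
move=> hallN hallF totF X; set U := (\bigcup_(D in F) D)%classic.
suff [D hallD DU] : exists2 D, hall_cond (prune N D) &
    forall p, p \in enum_fset (X `*` nbhd N X)%fset -> U p -> D p.
  apply: leq_trans (hallD X) (fsubset_leq_card _).
  apply: nbhdS => x xX; apply/fsubsetP => y; rewrite !in_prune => /andP[yx].
  rewrite yx; apply: contra => /asboolP Uxy; apply/asboolP; apply: DU => //.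
  rewrite [_ \in _]in_fsetM xX; apply/in_nbhdP; by exists x.
have hall0 : hall_cond (prune N set0).
  apply: hall_cond_ext hallN => x; apply/fsetP => y; rewrite in_prune.
  by rewrite asboolF ?andbT.
suff [D FD DU] : exists2 D, F D \/ D = set0 &
    forall p, p \in enum_fset (X `*` nbhd N X)%fset -> U p -> D p.
  by exists D => //; case: FD => [/hallF//|->].
elim: (enum_fset _) => [|p s [D FD DU]]; first by exists set0 => //; right.
have [[D' FD' D'p]|nUp] := pselect (U p); last first.
  by exists D => // q; rewrite inE => /predU1P[-> /nUp|/DU].
have [DD'|D'D] : (D `<=` D' \/ D' `<=` D)%classic.
  by case: FD => [FD|->]; [exact: totF|left; exact: sub0set].
- exists D'; first by left.
  by move=> q; rewrite inE => /predU1P[->//|qs /(DU _ qs)/DD'].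
exists D => // q; rewrite inE => /predU1P[-> _|/DU//].
exact: D'D.
Qed.

(** Zorn's lemma gives a maximal set of deleted edges that preserves the
    marriage condition. By [hall_drop_edge] exactly one edge is left at each
    point of [L], and the marriage condition for pairs is injectivity. *)
Lemma hall N : hall_cond N ->
  exists f : L -> K, injective f /\ forall x, f x \in N x.
Proof.
move=> hallN; have [F FP totF|D [hallD Dmax]] :=
  @Zorn_bigcup _ [set D | hall_cond (prune N D)]%classic.
  by apply: hall_prune_chain => // D /FP.
pose M := prune N D.
have M_uniq x a b : a \in M x -> b \in M x -> a = b.
  move=> ax bx; apply: contrapT => /eqP ab.
  have maxD c : c \in M x -> ~ hall_cond (drop_edge M x c).
    rewrite in_prune => /andP[_ /asboolPn nDc] hallMc.
    apply: (Dmax ((x, c) |` D)%classic).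
      split; first by move=> p Dp; right.
      by move=> /(_ (x, c)) DcD; apply: nDc; apply: DcD; left.
    by apply: hall_cond_ext hallMc => z; rewrite prune_drop_edge.
  by have [/maxD|/maxD] := hall_drop_edge hallD ax bx ab; apply.
have /choice[f fM] x : exists y, y \in M x.
  have := hallD [fset x]%fset; rewrite cardfs1 cardfs_gt0 => /fset0Pn[y].
  by move=> /in_nbhdP[z]; rewrite inE => /eqP ->; exists y.
exists f; split=> [x z fxz|x]; last by have := fM x; rewrite in_prune => /andP[].
apply: contrapT => /eqP xz; have := hallD [fset x; z]%fset.
have /fsubset_leq_card : (nbhd M [fset x; z] `<=` [fset f x])%fset.
  apply/fsubsetP => y /in_nbhdP[t tX yM]; rewrite in_fset1; apply/eqP.
  move: tX; rewrite in_fset2 => /orP[] /eqP tE; rewrite tE in yM.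
    exact: M_uniq yM (fM x).
  by rewrite fxz; exact: M_uniq yM (fM z).
by rewrite cardfs1 cardfs2 xz => le1 le2; have := leq_trans le2 le1.
Qed.

End Hall.

(** * Folner sets in amenable groups *)

Section Folner.
Variables (R : realType) (Q : groupType).
Implicit Types S X : {fset Q}.

Definition fmul S X : {fset Q} := [fset s * q | s in S, q in X]%fset.

Lemma mem_fmul S X s q : s \in S -> q \in X -> s * q \in fmul S X.
Proof. by move=> sS qX; exact: in_imfset2. Qed.

Lemma fmulA S T X : fmul S (fmul T X) = fmul (fmul S T) X.
Proof.
apply/fsetP => x; apply/imfset2P/imfset2P.
  move=> [s sS [_ /imfset2P[t tT [q qX ->]] ->]].
  by exists (s * t); [exact: mem_fmul|exists q; rewrite ?mulgA].
move=> [_ /imfset2P[s sS [t tT ->]] [q qX ->]].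
by exists s => //; exists (t * q); rewrite ?mulgA //; exact: mem_fmul.
Qed.

Section Mean.
Variable mu : set Q -> R.
Hypotheses (muD : forall A B, (A `&` B = set0)%classic ->
              mu (A `|` B)%classic = (mu A + mu B)%R)
           (muM : forall g A, mu ((fun x => g * x) @` A)%classic = mu A).

(** The pieces, on which [f] is a left translation by one element of [s], are
    split off one at a time; injectivity keeps their images disjoint. *)
Lemma mean_piecewise (f : Q -> Q) (s : seq Q) (A : set Q) : injective f ->
  (forall q, A q -> f q * q^-1 \in s) -> mu (f @` A)%classic = mu A.
Proof.
move=> finj; elim: s A => [|a s IHs] A fs.
  have -> : A = set0 by rewrite -subset0 => q /fs.
  by rewrite image_set0.
pose A1 := (A `&` [set q | f q = a * q])%classic.
pose A2 := (A `\` [set q | f q = a * q])%classic.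
have AE : A = (A1 `|` A2)%classic by rewrite /A1 /A2 setUIDK.
have A12 : (A1 `&` A2 = set0)%classic.
  by rewrite -subset0 => q [[_ fq] [_ /(_ fq)]].
have fA12 : ((f @` A1) `&` (f @` A2) = set0)%classic.
  rewrite -subset0 => _ [[q [_ fq] <-] [q' [_ fq'] /finj qq']]; apply: fq'.
  by rewrite qq'.
rewrite AE image_setU !muD // (IHs A2) => [|q [Aq fq]].
  congr (_ + _)%R; rewrite -(muM a A1); congr mu.
  by apply/seteqP; split=> _ [q [Aq fq] <-]; exists q; rewrite //= fq.
have := fs q Aq; rewrite inE => /predU1P[fqa|//].
by case: fq; rewrite /= -fqa mulgVK.
Qed.

End Mean.

(** Otherwise the marriage theorem matches two copies of [Q] injectively into
    [Q] along the translations by [S], giving two disjoint sets of mean 1. *)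
Lemma amenable_no_doubling S : amenable R Q ->
  exists X, (#|` fmul S X| < 2 * #|` X|)%N.
Proof.
move=> [mu [mu_ge0 muT muD muM]]; apply: contrapT => /forallNP dbl.
pose N (p : Q * bool) : {fset Q} := fmul S [fset p.1]%fset.
have [X|f [finj fN]] := @hall _ _ N.
  pose X1 := [fset p.1 | p in X]%fset.
  apply: (@leq_trans (2 * #|` X1|)).
    pose layer (b : bool) := [fset (q, b) | q in X1]%fset.
    have XX1 : (X `<=` layer true `|` layer false)%fset.
      apply/fsubsetP => -[q b] qX; rewrite in_fsetU; apply/orP.
      have qX1 : q \in X1 by apply/imfsetP; exists (q, b).
      by case: b {qX}; [left|right]; exact: in_imfset.
    apply: leq_trans (fsubset_leq_card XX1) _; rewrite mul2n -addnn.
    have layer_le b : (#|` layer b| <= #|` X1|)%N by exact: leq_imfset_card.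
    apply: leq_trans (leq_add (layer_le true) (layer_le false)).
    by rewrite -cardfsUI leq_addr.
  apply: (@leq_trans #|` fmul S X1|); first by rewrite leqNgt; apply/negP/dbl.
  apply/fsubset_leq_card/fsubsetP => _ /imfset2P[s sS [_ /imfsetP[p pX ->] ->]].
  by apply/in_nbhdP; exists p => //; apply: mem_fmul; rewrite ?inE.
have mu1 b : mu ((fun q => f (q, b)) @` setT)%classic = 1%R.
  rewrite -muT; apply: (mean_piecewise muD muM (s := enum_fset S)).
    by move=> q q' /finj[].
  move=> q _; have /imfset2P[s sS [q']] := fN (q, b).
  by rewrite inE => /eqP -> ->; rewrite mulgK.
have := muD ((fun q => f (q, true)) @` setT)%classic
            ((fun q => f (q, false)) @` setT)%classic.
rewrite !mu1 => mu2; set U := (_ `|` _)%classic in mu2.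
have := mu_ge0 (~` U)%classic.
have : mu (U `|` ~` U)%classic = (mu U + mu (~` U)%classic)%R.
  by apply: muD; rewrite setICr.
rewrite setUv muT mu2; first lra.
by rewrite -subset0 => _ [[q _ <-] [q' _ /finj]].
Qed.

(** If no [X] is almost invariant under [S], multiplying by [S1 = 1 |` S]
    enlarges each finite set by a factor [1 + d] at least, and iterating this
    often enough doubles all finite sets. *)
Lemma folner S (d : R) : amenable R Q -> (0 < d)%R ->
  exists X, (0 < #|` X|)%N /\ forall s, s \in S ->
    (density R (fun q : X => (s * val q)%g \notin X) <= d)%R.
Proof.
move=> amQ d_gt0; apply: contrapT => /forallNP nfol.
pose S1 := (1 |` S)%fset.
have grow X : ((1 + d) * #|` X|%:R <= #|` fmul S1 X|%:R)%R.
  have [->|X_gt0] := posnP #|` X|; first by rewrite mulr0.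
  have := nfol X; rewrite not_andP => -[//|/existsNP[s /not_implyP[sS /negP]]].
  rewrite -ltNge /density -cardfE ltr_pdivlMr ?ltr0n // => /ltW dX.
  pose B := [fset q in X | s * q \notin X]%fset.
  have BX : (B `<=` X)%fset by apply/fsubsetP => q; rewrite !inE => /andP[].
  have BE : #|[pred q : X | s * val q \notin X]| = #|` B|.
    rewrite -(card_fsub BX); apply: eq_card => q.
    by rewrite in_fsub !inE fsvalP.
  rewrite BE in dX; rewrite mulrDl mul1r; apply: le_trans (lerD (lexx _) dX) _.
  rewrite -natrD ler_nat.
  have -> : #|` B| = #|` [fset s * q | q in B]%fset|.
    by apply/esym/card_imfset => q q' /mulgI.
  rewrite -cardfsUI; set Z := (_ `&` _)%fset.
  have -> : Z = fset0.
    apply/eqP; rewrite -fsubset0; apply/fsubsetP => x; rewrite in_fsetI.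
    move=> /andP[xX /imfsetP[q qB xE]]; move: qB; rewrite !inE /= => /andP[_].
    by rewrite -xE xX.
  rewrite cardfs0 addn0; apply/fsubset_leq_card/fsubsetP => x.
  rewrite in_fsetU => /orP[xX|/imfsetP[q /= qB ->]].
    by rewrite -[x]mul1g mem_fmul // fset1U1.
  by rewrite mem_fmul ?(fsubsetP BX) // /S1 in_fset1U sS orbT.
have growN n : exists T, forall X,
    ((1 + n%:R * d) * #|` X|%:R <= #|` fmul T X|%:R)%R.
  elim: n => [|n [T growT]].
    exists [fset 1]%fset => X; rewrite mul0r addr0 mul1r ler_nat.
    apply/fsubset_leq_card/fsubsetP => q qX.
    by rewrite -[q]mul1g mem_fmul // inE.
  exists (fmul S1 T) => X; rewrite -fmulA; apply: le_trans (grow _).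
  have d1 : (0 <= 1 + d)%R by rewrite addr_ge0 // ltW.
  apply: le_trans (ler_wpM2l d1 (growT X)); rewrite mulrA ler_wpM2r //.
  have : (0 <= n%:R * d * d)%R by rewrite !mulr_ge0 // ltW.
  by rewrite -natr1; lra.
have [n dn] : exists n, (1 <= n%:R * d)%R.
  exists (Num.bound d^-1); rewrite -ler_pdivrMr // div1r ltW //.
  by rewrite archi_boundP // invr_ge0 ltW.
have [T growT] := growN n; have [X] := amenable_no_doubling T amQ.
rewrite ltnNge => /negP; apply; rewrite -(ler_nat R).
apply: le_trans (growT X); rewrite natrM ler_wpM2r //; lra.
Qed.

End Folner.

(** * Extensions with amenable quotient *)

Section Extension.
Variables (R : realType) (G : groupType) (N : normalClosed G).

Definition quot_map (x : G) : quot N := \pi_(quot N)%qT x.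

Lemma quot_mapM : {morph quot_map : x y / x * y}.
Proof. exact: quot_piM. Qed.

Lemma quot_map1 : quot_map 1 = 1.
Proof. by apply: (mulgI (quot_map 1)); rewrite -quot_mapM !mulg1. Qed.

Lemma quot_mapV : {morph quot_map : x / x^-1}.
Proof.
by move=> x; apply: (mulgI (quot_map x)); rewrite -quot_mapM !mulgV quot_map1.
Qed.

Lemma quot_map_eq1 x : (quot_map x == 1) = (x \in N).
Proof.
rewrite -quot_map1 eq_sym; apply/eqP/idP => [/eqmodP|xN].
  by rewrite /= /coset_eq invg1 mul1g.
by apply/eqmodP; rewrite /= /coset_eq invg1 mul1g.
Qed.

Definition coset_rep (q : quot N) : G := generic_quotient.repr q.

Lemma coset_repK : cancel coset_rep quot_map.
Proof. exact: reprK. Qed.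

(** Almost actions are right actions, whereas the mean is left invariant, hence
    the inverse. *)
Definition shift (g : G) (q : quot N) : quot N := (quot_map g)^-1 * q.

Lemma shiftM g h q : shift (g * h) q = shift h (shift g q).
Proof. by rewrite /shift quot_mapM invgM mulgA. Qed.

Lemma shift1 q : shift 1 q = q.
Proof. by rewrite /shift quot_map1 invg1 mul1g. Qed.

(** The defect, in [N], of the equivariance of the section
    [coset_rep : quot N -> G]; the induced action on [quot N * B] is built from
    it. *)
Fact cocycle_in g q : (coset_rep q)^-1 * g * coset_rep (shift g q) \in N.
Proof.
rewrite -quot_map_eq1 !quot_mapM quot_mapV !coset_repK /shift.
by rewrite mulgA mulgK mulVg.
Qed.

Definition cocycle (g : G) (q : quot N) : subgrp N := SubGrp (cocycle_in g q).

Lemma cocycleM g h q : cocycle (g * h) q = cocycle g q * cocycle h (shift g q).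
Proof.
apply: val_inj; rewrite gmulfM /= -shiftM !mulgA.
by rewrite mulgK.
Qed.

Lemma cocycle1 q : cocycle 1 q = 1.
Proof.
apply: (mulgI (cocycle 1 q)).
by rewrite mulg1 -[q in X in _ * X]shift1 -cocycleM mulg1.
Qed.

Lemma cocycle_eq1 g q : quot_map g = 1 -> (cocycle g q == 1) = (g == 1).
Proof.
move=> g1; rewrite -(inj_eq val_inj) /= /shift g1 invg1 mul1g.
by rewrite -mulgA -[_ * _]/(g ^ coset_rep q) conjg_eq1.
Qed.

Section Induced.
Variables (B : finType) (psi : subgrp N -> B -> B) (K : {fset quot N}).

(** The action on [quot N * B] induced from that of [N] on [B], cut down to
    [K * B]. *)
Definition induced (g : G) (x : K * B) : K * B :=
  if insub (shift g (val x.1)) is Some q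
  then (q, psi (cocycle g (val x.1)) x.2) else x.

End Induced.

(** Over the points of [K] that do not leave [K], the multiplicativity of
    [induced] is the cocycle identity and that of [psi]. A nontrivial element
    outside [N] moves all points that it does not push out of [K]; one in [N]
    acts over each coset by a conjugate of itself, which is nontrivial. *)
Lemma sofic_by_amenable : sofic R (subgrp N) -> amenable R (quot N) -> sofic R G.
Proof.
move=> /soficP sN amQ; apply/soficP => F eps eps_gt0.
pose F2 : {fset G} := (F `|` [fset e * f | e in F, f in F])%fset.
set d := (eps / 3)%R; have d_gt0 : (0 < d)%R by rewrite divr_gt0.
have [K [K_gt0 folK]] := folner [fset (quot_map g)^-1 | g in F2]%fset amQ d_gt0.
pose leaves g (q : K) := shift g (val q) \notin K.
have leavesP g : g \in F2 -> (density R (leaves g) <= d)%R.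
  by move=> gF; apply: folK; apply/imfsetP; exists g.
pose FN : {fset subgrp N} := [fset cocycle g q | g in F2, q in K]%fset.
have [B [psi [B_gt0 [mulP oneP freeP]]]] := sN FN d d_gt0.
have inF2 e : e \in F -> e \in F2 by move=> eF; rewrite inE eF.
have inFN e q : e \in F -> q \in K -> cocycle e q \in FN.
  by move=> eF qK; apply: in_imfset2 => //; exact: inF2.
have shiftK g (q : K) : (exists2 q' : K, val q' = shift g (val q) &
      forall b, induced psi g (q, b) = (q', psi (cocycle g (val q)) b)) \/ leaves g q.
  rewrite /leaves /induced /=; case: insubP => [q' q'K q'E|]; last by right.
  by left; exists q'.
exists (K * B)%type, (induced psi (K := K)).
split; first by rewrite card_prod muln_gt0 -cardfE K_gt0.
split=> [e f eF fF||e eF e1].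
- have efF2 : e * f \in F2.
    by rewrite inE; apply/orP; right; exact: in_imfset2.
  pose bad (q : K) := leaves e q || leaves (e * f) q.
  pose Q (x : K * B) := ~~ bad x.1 &&
    (psi (cocycle e (val x.1) * cocycle f (shift e (val x.1))) x.2 !=
     psi (cocycle f (shift e (val x.1))) (psi (cocycle e (val x.1)) x.2)).
  have badP : (density R (fun x : K * B => bad x.1) <= d + d)%R.
    apply: le_trans (lerD (leavesP e (inF2 e eF)) (leavesP _ efF2)).
    apply: (@le_trans _ _ (density R bad)); first exact: density_fst.
    exact: density_cover.
  have QP : (density R Q <= d)%R.
    apply: density_fiber => [|q]; first exact: ltW.
    have [bq|] := boolP (bad q).
      by rewrite density_eq0 ?ltW // => b; rewrite /Q /= bq.
    rewrite negb_or !negbK => /andP[eq _].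
    apply: le_trans (mulP _ _ (inFN e _ eF (fsvalP q)) (inFN f _ fF eq)).
    by apply: density_sub => b /andP[].
  have -> : eps = (d + d + d)%R by rewrite /d; lra.
  apply: le_trans (lerD badP QP); apply: density_cover => -[q b].
  rewrite /Q /=; case: (boolP (bad q)) => //; rewrite negb_or => /andP[neq nefq] /=.
  apply: contra => /eqP psiE.
  have [[q1 q1E ->]|/(negP neq)//] := shiftK e q.
  have [[q2 q2E ->]|/(negP nefq)//] := shiftK (e * f) q.
  have [[q3 q3E ->]|] := shiftK f q1.
    rewrite xpair_eqE q1E -psiE cocycleM eqxx andbT -val_eqE.
    by rewrite q2E q3E q1E shiftM.
  by rewrite /leaves q1E -shiftM => /(negP nefq).
- have -> : eps = (d + 2 * d)%R by rewrite /d; lra.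
  apply: (@le_trans _ _ d); last lra.
  apply: le_trans oneP; apply: density_snd => q b.
  apply: contra => /eqP b1; have [[q1 q1E ->]|] := shiftK 1 q.
    by rewrite xpair_eqE cocycle1 b1 eqxx andbT -val_eqE q1E shift1.
  by rewrite /leaves shift1 fsvalP.
apply: (@le_trans _ _ d); last by rewrite /d; lra.
have [pe1|pe1] := eqVneq (quot_map e) 1; last first.
  apply: le_trans (leavesP e (inF2 e eF)); apply: density_fst => q b.
  have [[q1 q1E ->]|//] := shiftK e q; rewrite xpair_eqE => /andP[/eqP qq _].
  move: q1E; rewrite qq /shift -[LHS]mul1g => /mulIg/esym/eqP.
  by rewrite invg_eq1 (negbTE pe1).
apply: density_fiber => [|q]; first exact: ltW.
have c1 : cocycle e (val q) != 1 by rewrite cocycle_eq1.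
apply: le_trans (freeP _ (inFN e _ eF (fsvalP q)) c1).
apply: density_sub => b; have [[q1 q1E ->]|] := shiftK e q.
  by rewrite xpair_eqE => /andP[].
by rewrite /leaves /shift pe1 invg1 mul1g fsvalP.
Qed.

End Extension.

Unset Implicit Arguments.
Local Close Scope group_scope.

Theorem theorem1 (R : realType) :
  (* direct products *)
  (forall (I : Type) (G : I -> groupType),
     (forall i : I, sofic R (G i)) -> sofic R (dprod G)) /\
  (* subgroups *)
  (forall (G : groupType) (S : groupClosed G),
     sofic R G -> sofic R (subgrp S)) /\
  (* inverse limits *)
  (forall (d : Order.disp_t) (I : preorderType d) (G : inverse_system I),
     (forall i : I, sofic R (G i)) -> sofic R (invlim G)) /\
  (* direct limits *)
  (forall (d : Order.disp_t) (I : preorderType d) (G : directed_system I),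
     (forall i : I, sofic R (G i)) -> sofic R (dirlim G)) /\
  (* free products *)
  (forall (I : Type) (G : I -> groupType),
     (forall i : I, sofic R (G i)) -> sofic R (freeprod G)) /\
  (* sofic-by-amenable extensions *)
  (forall (G : groupType) (N : normalClosed G),
     sofic R (subgrp N) -> amenable R (quot N) -> sofic R G).
Proof.
split; first exact: sofic_dprod.
split; first exact: sofic_subgrp.
split; first exact: sofic_invlim.
split; first exact: sofic_dirlim.
split; first exact: sofic_freeprod.
exact: sofic_by_amenable.
Qed.
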